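(* Suppose $X$ is sub-Gaussian with constant $C_1$. Then $$\mathbb E[\mathcal E^{PCA}_d]\le C\sum_{j\le d}\max\bigg(\sqrt{\frac{\lambda_j\operatorname{tr}_{\ge j}(\Sigma)}{n}},\ \frac{\operatorname{tr}_{\ge j}(\Sigma)}{n}\bigg),$$ where $C>0$ is a constant depending only on $C_1$.
   Context: Let $(\mathcal H,\langle\cdot,\cdot\rangle)$ be a separable real Hilbert space of dimension $p\in\mathbb N\cup\{+\infty\}$ with norm $\|\cdot\|$, and let $X$ be a centered $\mathcal H$-valued random variable with $\mathbb E\|X\|^2<\infty$. Its covariance operator is $\Sigma=\mathbb E[X\otimes X]$, where $(u\otimes v)x=\langle v,x\rangle u$. Its eigenvalues (with multiplicity) are $\lambda_1\ge\lambda_2\ge\dots>0$, with corresponding eigenvectors $u_1,u_2,\dots$ which are assumed to form an orthonormal basis of $\mathcal H$ and are fixed; $P_j=u_j\otimes u_j$, $P_{\le d}=\sum_{j\le d}P_j$. Put $\operatorname{tr}_{\ge r}(\Sigma)=\sum_{j\ge r}\lambda_j$. Let $X_1,\dots,X_n$ be $n\ge1$ independent copies of $X$, $\hat\Sigma=\frac1n\sum_{i=1}^nX_i\otimes X_i$, with eigenvalues $\hat\lambda_1\ge\hat\lambda_2\ge\dots\ge0$ and an orthonormal basis of eigenvectors $\hat u_1,\hat u_2,\dots$; $\hat P_j=\hat u_j\otimes\hat u_j$, $\hat P_{\le d}=\sum_{j\le d}\hat P_j$. Here $d$ is an integer with $1\le d<p$. The excess risk is $\mathcal E^{PCA}_d=\langle\Sigma,P_{\le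 d}-\hat P_{\le d}\rangle$ with $\langle S,T\rangle=\operatorname{tr}(S^*T)$. $X$ is sub-Gaussian with constant $C_1$ if $\mathbb E\|X\|^2<\infty$ and $\sup_{k\ge1}k^{-1/2}\mathbb E[|\langle X,u\rangle|^k]^{1/k}\le C_1\mathbb E[\langle X,u\rangle^2]^{1/2}$ for all $u\in\mathcal H$. *)

(* Defs.v *)
From HB Require Import structures.
From mathcomp Require Import all_boot all_order all_algebra.
From mathcomp Require Import all_classical all_reals all_analysis.
Set Implicit Arguments.
Unset Strict Implicit.
Unset Printing Implicit Defensive.
Import Order.TTheory GRing.Theory Num.Theory.
Import numFieldNormedType.Exports.
Local Open Scope classical_set_scope.
Local Open Scope ring_scope.

(* A real Hilbert space is a complete normed module [H] with a form
   [ip : {dot H for idfun}] (bilinear, symmetric, positive definite) that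
   induces its norm.  A dimension in N u {+oo} is a [p : option nat], with
   [None] for +oo.  Families are indexed from 0: the vectors of an orthonormal
   basis are the [e j] with [below p j], and the values of [e] at other indices
   are irrelevant. *)

Definition below (p : option nat) (j : nat) : bool :=
  if p is Some m then (j < m)%N else true.

Section Hilbert.
Context {R : realType} {H : completeNormedModType R}.
Variable ip : {dot H for idfun}.
Implicit Types (p : option nat) (e : nat -> H) (A S : H -> H).

Definition induces_norm : Prop := forall x : H, `|x| ^+ 2 = ip x x.

Definition orthonormal_basis p e : Prop :=
  (forall j k, below p j -> below p k -> ip (e j) (e k) = (j == k)%:R) /\
  dense [set x : H | exists N (c : nat -> R),
                       x = \sum_(0 <= j < N | below p j) c j *: e j].

Definition tensor (u v : H) : H -> H := fun x => ip v x *: u.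

Definition projector e (d : nat) : H -> H :=
  fun x => \sum_(0 <= j < d) tensor (e j) (e j) x.

Definition is_adjoint S S' : Prop := forall x y, ip (S x) y = ip x (S' y).

(* The junk value 0 is returned when there is no adjoint; an adjoint is unique. *)
Definition adjoint S : H -> H := xget (fun=> 0) [set S' | is_adjoint S S'].

(* The trace is computed in a given orthonormal basis [e]; for a trace class
   operator the value does not depend on [e]. *)
Definition trace p e A : R :=
  (\big[+%R/0]_(0 <= j <oo | below p j) ip (A (e j)) (e j))%R.

Definition hs_inner p e S A : R := trace p e (adjoint S \o A).

Definition eigenbasis p S (lam : nat -> R) e : Prop :=
  [/\ orthonormal_basis p e,
      forall j, below p j -> S (e j) = lam j *: e j
    & forall j k, (j <= k)%N -> below p k -> lam k <= lam j].

(* [e] is the eigenbasis of [S] and [f] the one of its estimator. *)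
Definition excess_risk p S e (d : nat) (f : nat -> H) : R :=
  hs_inner p e S (fun x => projector e d x - projector f d x).

End Hilbert.

Definition tail_trace {R : realType} (p : option nat) (lam : nat -> R)
    (r : nat) : R :=
  (\big[+%R/0]_(r <= j <oo | below p j) lam j)%R.

Section Probability.
Context {R : realType} {H : completeNormedModType R}.
Variable ip : {dot H for idfun}.
Context {dT : measure_display} {T : measurableType dT} (P : probability T R).
Implicit Types X Y : T -> H.

Definition borel : set (set H) := <<s @open H >>.

Definition random_vector Y : Prop :=
  measurable_fun [set: T] (Y : T -> g_sigma_algebraType (@open H)).

(* [m] is the Bochner expectation of [Y]: as [H] is separable, it exists when
   [`|Y|] is integrable, and it is then determined by its inner products. *)
Definition is_mean Y (m : H) : Prop :=
  [/\ random_vector Y,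
      ('E_P[(fun t => `|Y t|%R)] < +oo)%E
    & forall v, ('E_P[(fun t => ip (Y t) v)])%E = (ip m v)%:E].

(* The expectation of the random operator [X (x) X], taken pointwise. *)
Definition is_covariance X (Sigma : H -> H) : Prop :=
  forall x, is_mean (fun t => tensor ip (X t) (X t) x) (Sigma x).

Definition square_integrable X : Prop :=
  ('E_P[(fun t => (`|X t| ^+ 2)%R)] < +oo)%E.

Definition sub_gaussian X (C1 : R) : Prop :=
  square_integrable X /\
  forall u : H,
    (ereal_sup [set ((k%:R `^ (- 2^-1))%R)%:E *
                    'E_P[(fun t => (`|ip (X t) u| ^+ k)%R)] `^ (k%:R^-1)
               | k in [set k : nat | (1 <= k)%N]]
     <= C1%:E * 'E_P[(fun t => (ip (X t) u ^+ 2)%R)] `^ (2^-1))%E.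

Definition same_law X Y : Prop :=
  forall B, borel B -> P (X @^-1` B) = P (Y @^-1` B).

Definition independent n (Xs : 'I_n -> T -> H) : Prop :=
  forall B : 'I_n -> set H, (forall i, borel (B i)) ->
    P (\bigcap_(i in [set: 'I_n]) (Xs i @^-1` B i)) =
    (\prod_(i < n) P (Xs i @^-1` B i))%E.

Definition iid_copies X n (Xs : 'I_n -> T -> H) : Prop :=
  [/\ forall i, random_vector (Xs i),
      forall i, same_law (Xs i) X
    & independent Xs].

Definition empirical_covariance n (Xs : 'I_n -> T -> H) (t : T) : H -> H :=
  fun x => n%:R^-1 *: \sum_(i < n) tensor ip (Xs i t) (Xs i t) x.

End Probability.

(* Main.v *)
Require Import Defs.
From HB Require Import structures.
From mathcomp Require Import all_boot all_order all_algebra.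
From mathcomp Require Import all_classical all_reals all_analysis.
From mathcomp Require Import measurable_realfun.
From mathcomp Require Import ring lra zify.
Set Implicit Arguments.
Unset Strict Implicit.
Unset Printing Implicit Defensive.
Import Order.TTheory GRing.Theory Num.Theory.
Import numFieldNormedType.Exports.
Local Open Scope classical_set_scope.
Local Open Scope ring_scope.

(** Let D be the empirical covariance minus Sigma.  As the estimated projector Q
    maximises the empirical variance, the excess risk is at most <D, Q - P>.
    The rows j < d of D are bounded in Hilbert-Schmidt norm, and each contributes
    at most 3 |(D_jk)_{k >= j}|, of mean of order sqrt(lam_j tr_{>= j} / n).  The
    remaining block of D, on the indices at least d, contributes at most d times
    the supremum of its quadratic form over the unit ball.  This supremum is
    bounded without a logarithmic factor by a PAC-Bayes argument: a point x of
    the ball is perturbed by a discrete Gaussian noise of variance lam_d / tr_{>= d},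
    so that the relative entropy to the unshifted noise is at most
    tr_{>= d} / (2 lam_d), while the variance of X in the perturbed direction
    stays of order lam_d, where the Laplace transform of <X, y>^2 is under
    control.  The infinite dimension enters only through a truncation whose cost
    is made negligible. *)

(** * A discrete Gaussian PAC-Bayes bound *)

(** The estimated projector depends on the sample, so the error D has to be controlled uniformly
    over projectors of rank d. On the first d rows Cauchy-Schwarz does this without any supremum. On
    the remaining block the same method would give tr_{>= d} / sqrt n, which can be far larger than
    sqrt(lam_d tr_{>= d} / n); hence the bound on the quadratic form there. Its factor d is
    harmless: lam_j and tr_{>= j} decrease in j, so each of the d copies is charged to one j < d.
    The noise is discrete so that prior and posterior are finite families of weights: the bound
    becomes an inequality at each sample point with finitely many exponentials, and the
    measurability of a supremum never arises. The noise is conditioned on an ellipsoid because the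
    Laplace transform of <X, y>^2 is controlled only for arguments up to the order of 1 / <Sigma y,
    y>, which an unconstrained y would violate. In the final constant 804 kappa + 2, the three row
    norms give 36 kappa, the block gives 768 kappa, and lattice rounding and truncation give 1
    each. *)

Section DiscreteGaussian.
Context {R : realType}.
Implicit Types (g : R).

Definition centered M (i : 'I_M.*2.+1) : R := i%:R - M%:R.

Lemma centered_rev M (i : 'I_M.*2.+1) : centered (rev_ord i) = - centered i.
Proof.
have := ltn_ord i; rewrite ltnS => im; rewrite /centered /= subSS natrB //.
have -> : M.*2%:R = M%:R + M%:R :> R by rewrite -natrD addnn.
lra.
Qed.

Lemma sum_centered_sqr (F : R -> R) M :
  \sum_(i < M.*2.+1) F (centered i ^+ 2) =
  F 0 + 2 * \sum_(1 <= k < M.+1) F (k%:R ^+ 2).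
Proof.
rewrite /centered -(big_mkord xpredT (fun k => F ((k%:R - M%:R) ^+ 2))).
elim: M => [|M IH].
  rewrite double0 big_nat1 big_geq // subrr expr0n /=; lra.
rewrite doubleS big_nat_recl // big_nat_recr // [in RHS]big_nat_recr //= mulrDr.
rewrite [RHS]addrA -IH.
have E k : k.+1%:R - M.+1%:R = k%:R - M%:R :> R by rewrite -!natr1; lra.
under eq_bigr do rewrite E.
have -> : M.*2.+2%:R - M.+1%:R = M.+1%:R :> R.
  by rewrite -!natr1 -addnn natrD; lra.
by rewrite sub0r sqrrN; lra.
Qed.

(** The terms of index 2k and 2k+1 on the left are both at most the term of index k on the right,
    since g (2k)^2 / 4 = g k^2. *)
Lemma gauss_sum_dilate g q : 0 <= g ->
  \sum_(0 <= k < q.*2) expR (- (g * k%:R ^+ 2 / 4)) <=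
  2 * \sum_(0 <= k < q) expR (- (g * k%:R ^+ 2)).
Proof.
move=> g0; elim: q => [|q IH]; first by rewrite !big_geq // mulr0.
rewrite doubleS !big_nat_recr //= mulrDr -addrA; apply: lerD => //.
have a : expR (- (g * q.*2%:R ^+ 2 / 4)) = expR (- (g * q%:R ^+ 2)).
  by congr expR; rewrite -addnn natrD; field.
have b : expR (- (g * q.*2.+1%:R ^+ 2 / 4)) <= expR (- (g * q%:R ^+ 2)).
  rewrite ler_expR lerN2 -natr1 -addnn natrD -mulrA ler_wpM2l //.
  have : (0 : R) <= q%:R by []. move: (q%:R : R) => z z0; rewrite ler_pdivlMr //; by nra.
by rewrite a; lra.
Qed.

(** Trades the factor s for a dilation by 2 of the Gaussian, which [gauss_sum_dilate] then undoes.
    It amounts to s <= (1 + 3s/8)^2 <= exp(3s/4). *)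
Lemma mul_expN_le (s : R) : 0 <= s -> s * expR (- s) <= expR (- (s / 4)).
Proof.
move=> s0; have -> : expR (- (s / 4)) = expR (3 * s / 4) * expR (- s).
  by rewrite -expRD; congr expR; lra.
rewrite ler_wpM2r ?expR_ge0 //.
have h : 1 + 3 * s / 8 <= expR (3 * s / 8) by apply: expR_ge1Dx.
have -> : expR (3 * s / 4) = expR (3 * s / 8) ^+ 2.
  by rewrite -expRM_natl; congr expR; lra.
move: (expR (3 * s / 8)) h => e h.
have : (1 + 3 * s / 8) ^+ 2 <= e ^+ 2 by rewrite ler_pXn2r ?nnegrE //; lra.
by nra.
Qed.

(** The variance is at most 4 / g, against 1 / (2g) for the continuous Gaussian; the point is that
    the bound is uniform in the mesh, that is in g, and in the cutoff M. *)
Lemma gauss_second_moment g M : 0 < g ->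
  \sum_(i < M.*2.+1) expR (- (g * centered i ^+ 2)) * centered i ^+ 2 <=
  4 / g * \sum_(i < M.*2.+1) expR (- (g * centered i ^+ 2)).
Proof.
move=> g0.
rewrite (sum_centered_sqr (fun s => expR (- (g * s)) * s)).
rewrite (sum_centered_sqr (fun s => expR (- (g * s)))).
rewrite mulr0 add0r !mulr0 oppr0 expR0.
set A := \sum_(1 <= k < M.+1) expR (- (g * k%:R ^+ 2)).
suff : \sum_(1 <= k < M.+1) expR (- (g * k%:R ^+ 2)) * k%:R ^+ 2 <=
       g^-1 * (2 * (1 + A)).
  have A0 : 0 <= A by apply: sumr_ge0 => *; exact: expR_ge0.
  have gi : 0 < g^-1 by rewrite invr_gt0.
  move=> h; apply: (@le_trans _ _ (2 * (g^-1 * (2 * (1 + A))))); first by lra.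
  by nra.
apply: (@le_trans _ _ (g^-1 * \sum_(1 <= k < M.+1) expR (- (g * k%:R ^+ 2 / 4)))).
  rewrite mulr_sumr; apply: ler_sum => k _.
  rewrite ler_pdivlMl // mulrCA mulrC.
  by apply: mul_expN_le; rewrite mulr_ge0 ?exprn_ge0 // ltW.
apply: ler_wpM2l; first by rewrite invr_ge0 ltW.
apply: (@le_trans _ _ (\sum_(0 <= k < M.+1.*2) expR (- (g * k%:R ^+ 2 / 4)))).
  rewrite (@big_cat_nat _ _ _ M.+1 0) //=; last by rewrite -addnn leq_addr.
  rewrite [X in _ <= X + _]big_ltn // -addrA addrCA lerDl addr_ge0 ?expR_ge0 //.
  by apply: sumr_ge0 => *; exact: expR_ge0.
apply: le_trans (gauss_sum_dilate _ (ltW g0)) _.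
by rewrite big_ltn // expr0n /= mulr0 oppr0 expR0.
Qed.

End DiscreteGaussian.

(** * Discrete Gaussian weights on a cube, and the variational inequality *)

Section GaussianCube.
Context {R : realType} (m M : nat) (g : R).
Hypothesis g0 : 0 < g.
Notation J := {ffun 'I_m -> 'I_M.*2.+1}.
Implicit Types (y z : J) (c x : 'I_m -> R).

Definition coords y (i : 'I_m) : R := centered (y i).

Definition gweight y : R := \prod_i expR (- (g * coords y i ^+ 2)).

Lemma gweight_gt0 y : 0 < gweight y.
Proof. by apply: prodr_gt0 => i _; exact: expR_gt0. Qed.

Lemma gweightE y : gweight y = expR (- (g * \sum_i coords y i ^+ 2)).
Proof. by rewrite /gweight -expR_sum sumrN mulr_sumr. Qed.

Lemma gweight_coord i :
  \sum_y gweight y * coords y i ^+ 2 <= 4 / g * \sum_y gweight y.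
Proof.
pose w (k : 'I_M.*2.+1) : R := expR (- (g * centered k ^+ 2)).
have E1 : \sum_y gweight y = \prod_(j < m) \sum_k w k by rewrite bigA_distr_bigA.
have E2 : \sum_y gweight y * coords y i ^+ 2 =
    \prod_(j < m) \sum_k w k * (if j == i then centered k ^+ 2 else 1).
  rewrite bigA_distr_bigA; apply: eq_bigr => y _.
  rewrite big_split /=; congr (_ * _).
  rewrite (bigD1 i) //= eqxx big1 ?mulr1 // => j /negPf->//.
rewrite E1 E2 (bigD1 i) //= [X in _ <= _ * X](bigD1 i) //= mulrA eqxx.
rewrite [X in X * _ <= _](_ : _ = \sum_k w k * centered k ^+ 2) //.
rewrite [X in _ * X <= _](_ : _ = \prod_(j < m | j != i) \sum_k w k); last first.
  by apply: eq_bigr => j /negPf ->; under eq_bigr do rewrite mulr1.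
apply: ler_wpM2r.
  by apply: prodr_ge0 => *; apply: sumr_ge0 => *; exact: expR_ge0.
exact: gauss_second_moment.
Qed.

Definition ellipsoid c (s : R) : pred J :=
  fun y => \sum_i c i * coords y i ^+ 2 <= s.

(** Markov's inequality: the mean of the quadratic form defining the ellipsoid is at most 1/2, so at
    most half of the mass lies outside. *)
Lemma ellipsoid_half c : (forall i, 0 <= c i) -> 4 / g * \sum_i c i <= 1 / 2 ->
  \sum_y gweight y <= 2 * \sum_(y | ellipsoid c 1 y) gweight y.
Proof.
move=> c0 hc; pose Z := \sum_y gweight y.
have Z0 : 0 <= Z by apply: sumr_ge0 => y _; exact/ltW/gweight_gt0.
suff : \sum_(y | ~~ ellipsoid c 1 y) gweight y <= 1 / 2 * Z.
  have : Z = \sum_(y | ellipsoid c 1 y) gweight y +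
             \sum_(y | ~~ ellipsoid c 1 y) gweight y.
    by rewrite /Z (bigID (ellipsoid c 1)).
  by rewrite -/Z => E h; lra.
apply: (@le_trans _ _ (\sum_y gweight y * \sum_i c i * coords y i ^+ 2)).
  rewrite [X in _ <= X](bigID (ellipsoid c 1)) /= -[X in X <= _]add0r; apply: lerD.
    apply: sumr_ge0 => y _; rewrite mulr_ge0 ?(ltW (gweight_gt0 y)) //.
    by apply: sumr_ge0 => i _; rewrite mulr_ge0 ?sqr_ge0.
  apply: ler_sum => y; rewrite /ellipsoid -ltNge => h.
  by rewrite ler_peMr ?(ltW h) // (ltW (gweight_gt0 y)).
under eq_bigr do rewrite mulr_sumr.
rewrite exchange_big /=.
apply: (@le_trans _ _ (\sum_i c i * (4 / g * Z))).
  apply: ler_sum => i _; under eq_bigr do rewrite mulrCA.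
  by rewrite -mulr_sumr ler_wpM2l // gweight_coord.
by rewrite -mulr_suml mulrCA mulrA ler_wpM2r.
Qed.

Definition flip y : J := [ffun i => rev_ord (y i)].

Lemma flipK : involutive flip.
Proof. by move=> y; apply/ffunP => i; rewrite !ffunE rev_ordK. Qed.

Lemma coords_flip y i : coords (flip y) i = - coords y i.
Proof. by rewrite /coords ffunE centered_rev. Qed.

Lemma ellipsoid_flip c s y : ellipsoid c s (flip y) = ellipsoid c s y.
Proof.
by rewrite /ellipsoid; under eq_bigr do rewrite coords_flip sqrrN.
Qed.

Lemma gweight_flip y : gweight (flip y) = gweight y.
Proof. by rewrite /gweight; under eq_bigr do rewrite coords_flip sqrrN. Qed.

Lemma sum_flip (F : J -> R) c s :
  \sum_(y | ellipsoid c s y) gweight y * F y =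
  \sum_(y | ellipsoid c s y) gweight y * F (flip y).
Proof.
rewrite (reindex_inj (inv_inj flipK)) /=.
by apply: eq_big => y; rewrite ?ellipsoid_flip ?gweight_flip.
Qed.

(** Addition of centered coordinates: both indices carry the offset M, and one offset is removed.
    Outside the cube the truncated subtraction and [inord] return junk, which the hypothesis of
    [coords_shift] excludes. *)
Definition shift (x y : J) : J := [ffun i => inord (x i + y i - M)].

Lemma coords_shift (x y : J) (i : 'I_m) :
  `|coords x i + coords y i| <= M%:R ->
  coords (shift x y) i = coords x i + coords y i.
Proof.
rewrite /coords /shift ffunE /centered => h.
have [h1 h2] : (M <= x i + y i)%N /\ (x i + y i <= M + M.*2)%N.
  move: h; rewrite ler_norml => /andP[a b]; split.
    by rewrite -(ler_nat R) natrD; lra.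
  have e : M.*2%:R = M%:R + M%:R :> R by rewrite -natrD addnn.
  by rewrite -(ler_nat R) 2!natrD e; lra.
rewrite inordK; last by lia.
by rewrite natrB // natrD; lra.
Qed.

Definition gmass c : R := \sum_(y | ellipsoid c 1 y) gweight y.

(** A linearised Gibbs variational principle: 1 + z <= exp z replaces the logarithm of the Laplace
    transform by the transform itself, which can be averaged over the sample. The level s is meant
    to be an upper bound of that logarithm. *)
Lemma tilt_le (w s a : R) : 0 <= w -> w * a <= w * s + w * expR (a - s) - w.
Proof.
by move=> w0; have := expR_ge1Dx (a - s); move: (expR _) => e h; nra.
Qed.

(** All that is required of a quadratic form: under this law the average of q (x + y) and q (x - y)
    is q x + q y. *)
Definition parallelogram (q : ('I_m -> R) -> R) :=
  forall x y : 'I_m -> R, q (fun i => x i + y i) + q (fun i => x i - y i) = 2 * q x + 2 * q y.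

(* The posterior is the law of [x] plus a discrete Gaussian conditioned on the
   ellipsoid; it is symmetric about [x], so that a quadratic form averages to
   its value at [x] plus a term that does not depend on [x]. *)
Lemma gaussian_variational c (s : R) (x : J) (q : ('I_m -> R) -> R) :
  (forall i, 0 <= c i) -> parallelogram q ->
  (forall y : J, ellipsoid c 1 y ->
    forall i, `|coords x i + coords y i| <= M%:R) ->
  ellipsoid c 1 x ->
  gmass c * q (coords x) <= gmass c * (g * \sum_i coords x i ^+ 2 + s) +
    \sum_(y | ellipsoid c 4 y) gweight y * expR (q (coords y) - s) -
    \sum_(y | ellipsoid c 1 y) gweight y * q (coords y).
Proof.
move=> c0 pq hM xE; set Z := gmass c.
(* [D y] is the logarithm of [gweight y] over the weight of x + y; by symmetry its mean, computed in
   [avgD], is g |x|^2, the relative entropy term. *)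
pose D y := g * (\sum_i (coords x i + coords y i) ^+ 2 - \sum_i coords y i ^+ 2).
pose plus y i := coords x i + coords y i.
have plusE y : ellipsoid c 1 y -> coords (shift x y) = plus y.
  by move=> yE; apply/funext => i; rewrite coords_shift //; exact: hM.
have avg : \sum_(y | ellipsoid c 1 y) gweight y * q (plus y) =
    Z * q (coords x) + \sum_(y | ellipsoid c 1 y) gweight y * q (coords y).
  have := sum_flip (fun y => q (plus y)) c 1.
  set S := \sum_(y | _) _ => E.
  suff : S + S = 2 * (Z * q (coords x) +
      \sum_(y | ellipsoid c 1 y) gweight y * q (coords y)) by lra.
  rewrite {2}E /S -big_split /= /Z /gmass mulr_suml -big_split mulr_sumr.
  apply: eq_bigr => y _; rewrite -[LHS]mulrDr.
  have -> : plus (flip y) = fun i => coords x i - coords y i.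
    by apply/funext => i; rewrite /plus coords_flip.
  by rewrite /plus pq /=; ring.
have avgD : \sum_(y | ellipsoid c 1 y) gweight y * D y =
    Z * (g * \sum_i coords x i ^+ 2).
  have := sum_flip D c 1.
  set S := \sum_(y | _) _ => E.
  suff : S + S = 2 * (Z * (g * \sum_i coords x i ^+ 2)) by lra.
  rewrite {2}E /S -big_split /= /Z /gmass mulr_suml mulr_sumr.
  apply: eq_bigr => y _; rewrite -mulrDr mulrCA; congr (_ * _).
  rewrite /D -mulrDr mulrCA; congr (_ * _).
  rewrite -!sumrB -big_split /= mulr_sumr; apply: eq_bigr => i _.
  by rewrite coords_flip; ring.
have H1 : \sum_(y | ellipsoid c 1 y) gweight y * q (plus y) <=
    \sum_(y | ellipsoid c 1 y) (gweight y * D y + gweight y * s +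
      gweight (shift x y) * expR (q (coords (shift x y)) - s)).
  apply: ler_sum => y yE.
  (* With [D y] added to the level, the exponential term carries the weight of x + y instead of that
     of y: the change of measure. *)
  apply: le_trans (tilt_le (D y + s) _ (ltW (gweight_gt0 y))) _.
  have -> : gweight (shift x y) * expR (q (coords (shift x y)) - s) =
            gweight y * expR (q (plus y) - (D y + s)).
    rewrite plusE // !gweightE plusE // -!expRD; congr expR.
    by rewrite /D /plus; ring.
  by have := gweight_gt0 y; lra.
(* Translation by x is injective from level 1 into level 4, as (a + b)^2 <= 2 a^2 + 2 b^2, and the
   terms outside its image are nonnegative. *)
have H2 : \sum_(y | ellipsoid c 1 y)
      gweight (shift x y) * expR (q (coords (shift x y)) - s) <=
    \sum_(y | ellipsoid c 4 y) gweight y * expR (q (coords y) - s).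
  pose F y := gweight y * expR (q (coords y) - s).
  pose E1 := (finset (ellipsoid c 1) : {set J}).
  have inj : {in E1 &, injective (shift x)}.
    move=> y z; rewrite !inE => yE zE e; apply/ffunP => i.
    have : plus y i = plus z i by rewrite -!plusE // e.
    rewrite /plus => /addrI; rewrite /coords /centered => /addIr /eqP.
    by rewrite eqr_nat => /eqP; exact: val_inj.
  rewrite -[X in X <= _](_ : \sum_(y in shift x @: E1) F y = _).
    2: by rewrite big_imset //=; apply: eq_bigl => y; rewrite inE.
  rewrite [X in _ <= X](bigID (mem (shift x @: E1))) /=.
  rewrite -[X in X <= _]addr0; apply: lerD.
    rewrite le_eqVlt; apply/orP; left; apply/eqP; apply: eq_bigl => z.
    rewrite andb_idl // => /imsetP[y]; rewrite inE => yE ->.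
    rewrite /ellipsoid plusE //.
    apply: (@le_trans _ _ (\sum_i (2 * (c i * coords x i ^+ 2) +
                                    2 * (c i * coords y i ^+ 2)))).
      apply: ler_sum => i _; rewrite /plus.
      have := c0 i; have := sqr_ge0 (coords x i - coords y i).
      by move: (coords x i) (coords y i) (c i) => X Y C; nra.
    rewrite big_split /= -!mulr_sumr; move: xE yE; rewrite /ellipsoid; lra.
  by apply: sumr_ge0 => y _; rewrite mulr_ge0 ?expR_ge0 // ltW // gweight_gt0.
move: H1; rewrite avg !big_split /= avgD -mulr_suml -/(gmass c) -/Z; lra.
Qed.

End GaussianCube.

(** Rounding goes towards 0, so that a rounded point of the unit ball stays in the unit ball. *)
Lemma lattice_round {R : realType} (h v : R) M : 0 < h -> `|v| <= M%:R * h ->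
  exists k : 'I_M.*2.+1,
    `|h * centered k| <= `|v| /\ `|v - h * centered k| <= h.
Proof.
move=> h0 hM; set n := Num.truncn (`|v| / h).
have v0 : 0 <= `|v| / h by rewrite divr_ge0 // ltW.
have /andP[n1 n2] := truncn_itv v0.
have nM : (n <= M)%N.
  by rewrite -(ler_nat R); apply: le_trans n1 _; rewrite ler_pdivrMr.
move: n1 n2; rewrite ler_pdivlMr // ltr_pdivrMr // -/n -natr1 => n1 n2.
have e : M.*2%:R = M%:R + M%:R :> R by rewrite -natrD addnn.
have n0 : (0 : R) <= n%:R by [].
case: (leP 0 v) => [v_ge0|v_lt0].
  have L : (M + n < M.*2.+1)%N by rewrite ltnS -addnn leq_add2l.
  exists (Ordinal L); rewrite /centered /= natrD addrAC subrr add0r.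
  have nh : 0 <= h * n%:R by rewrite mulr_ge0 // ltW.
  move: n1 n2; rewrite (ger0_norm nh) (ger0_norm v_ge0) => n1 n2.
  by rewrite ger0_norm; last lra; split; lra.
have L : (M - n < M.*2.+1)%N by rewrite ltnS -addnn (leq_trans (leq_subr _ _)) ?leq_addr.
exists (Ordinal L); rewrite /centered /= natrB // addrAC subrr add0r mulrN normrN.
have nh : 0 <= h * n%:R by rewrite mulr_ge0 // ltW.
move: n1 n2; rewrite (ger0_norm nh) ltr0_norm // opprK => n1 n2; split; first by lra.
by rewrite ler0_norm; lra.
Qed.

(* The points [pt y] and the weights do not depend on [q]: averaged over a random
   quadratic form, the last sum, the value of the form at the noise alone,
   vanishes, and the exponential sum is a combination of Laplace transforms. *)
Lemma gaussian_net {R : realType} m (l : 'I_m -> R) (b h : R) :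
  (forall i, 0 <= l i <= 1) -> 0 < b -> b * \sum_i l i <= 1 -> 0 < h ->
  exists (J : finType) (pt : J -> 'I_m -> R) (wt nt : J -> R) (good : pred J),
    [/\ forall y, 0 <= wt y,
        \sum_(y | good y) wt y <= 2,
        forall y, good y -> \sum_i l i * pt y i ^+ 2 <= 128 &
        forall v : 'I_m -> R, \sum_i v i ^+ 2 <= 1 ->
        exists x : 'I_m -> R,
          [/\ forall i, `|x i| <= `|v i|, forall i, `|v i - x i| <= h &
          forall q s, parallelogram q ->
            q x <= (2 * b)^-1 + s + \sum_(y | good y) wt y * expR (q (pt y) - s)
                   + \sum_y nt y * q (pt y)]].
Proof.
move=> l01 b0 bl h0.
have h20 : 0 < h ^+ 2 by rewrite exprn_gt0.
(* [e] keeps the ellipsoid bounded in directions where [l i] vanishes. Its first bound gives [c i]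
   <= h^2, so the lattice points of the unit ball lie in the ellipsoid; its second makes the m extra
   terms cost at most 1/4 in [sumc]. *)
pose e : R := Num.min (h ^+ 2 / 2) (h ^+ 2 / (32 * b * m.+1%:R)).
have m10 : (0 : R) < m.+1%:R by [].
have e0 : 0 < e.
  by rewrite lt_min !divr_gt0 // mulr_gt0 // mulr_gt0.
have e1 : e <= h ^+ 2 / 2 by rewrite ge_min lexx.
have e2 : e * (32 * b * m%:R) <= h ^+ 2.
  apply: (@le_trans _ _ (e * (32 * b * m.+1%:R))).
    by rewrite ler_wpM2l ?(ltW e0) // ler_wpM2l ?mulr_ge0 ?(ltW b0) // ler_nat.
  rewrite -ler_pdivlMr; first by rewrite ge_min lexx orbT.
  by rewrite mulr_gt0 // mulr_gt0.
(* On the lattice of mesh h this is a Gaussian of variance parameter b, since g k^2 = (h k)^2 / (2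
   b). *)
pose g : R := h ^+ 2 / (2 * b).
have g0 : 0 < g by rewrite divr_gt0 // mulr_gt0.
(* Level 1 forces sum l_i (h y_i)^2 <= 32, and level 4 forces the announced 128. The factor 32 makes
   this part cost at most 1/4 in [sumc]. *)
pose c i := h ^+ 2 * l i / 32 + e.
have c_gt0 i : 0 < c i.
  have /andP[l0 _] := l01 i.
  by rewrite /c ltr_wpDl // divr_ge0 // mulr_ge0 // ltW.
have c0 i : 0 <= c i by exact: ltW.
have sumc : 4 / g * \sum_i c i <= 1 / 2.
  rewrite /c big_split /= -mulr_suml -mulr_sumr sumr_const card_ord.
  rewrite -[e *+ m]mulr_natr /g invf_div.
  rewrite -(ler_pM2r h20).
  rewrite [leLHS](_ : _ = h ^+ 2 * (b * \sum_i l i) / 4 + (e * (32 * b * m%:R)) / 4);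
    last by field; rewrite gt_eqF.
  move: e2; set E := e * _ => e2.
  have : h ^+ 2 * (b * \sum_i l i) <= h ^+ 2 * 1 by rewrite ler_pM2l.
  by lra.
pose X := (Num.truncn h^-1).+1.
have Xh : 1 <= X%:R * h.
  have hi : 0 <= h^-1 by rewrite invr_ge0 ltW.
  have /andP[_ /ltW Xh] := truncn_itv hi.
  by rewrite -ler_pdivrMr // mul1r.
pose L := (Num.truncn (1 + e^-1)).+1.
have Le : 1 <= e * L%:R ^+ 2.
  have : 0 <= 1 + e^-1 by rewrite addr_ge0 // invr_ge0 ltW.
  move=> /truncn_itv/andP[_ /ltW]; rewrite -/L => Le.
  have ei : 0 < e^-1 by rewrite invr_gt0.
  rewrite mulrC -ler_pdivrMr // mul1r.
  by move: (e^-1) ei Le => ei ei0; move: (L%:R) => z; nra.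
(* [L] bounds the coordinates of the ellipsoid and [X] those of the unit ball in units of h, so
   adding one of each never leaves the cube. *)
pose M := (L + X)%N.
have bound (y : {ffun 'I_m -> 'I_M.*2.+1}) : ellipsoid c 1 y ->
    forall i, `|coords y i : R| <= L%:R.
  move=> yE i; rewrite -(@ler_pXn2r _ 2) ?nnegrE // real_normK ?num_real //.
  rewrite -(ler_pM2l e0); apply: le_trans Le; apply: le_trans yE.
  rewrite (bigD1 i) //= ler_wpDr //.
    by apply: sumr_ge0 => j _; rewrite mulr_ge0 ?sqr_ge0.
  rewrite ler_wpM2r ?sqr_ge0 // /c lerDr divr_ge0 // mulr_ge0 ?(ltW h20) //.
  by have /andP[] := l01 i.
pose J := {ffun 'I_m -> 'I_M.*2.+1}.
pose Z : R := gmass M g c.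
have tot := ellipsoid_half M g0 c0 sumc.
have Z0 : 0 < Z.
  have : 0 < \sum_(y : J) gweight g y.
    rewrite (bigD1 [ffun=> ord0]) //= ltr_pwDl ?gweight_gt0 //.
    by apply: sumr_ge0 => y _; exact/ltW/gweight_gt0.
  by rewrite /Z /gmass; lra.
exists J, (fun y i => h * coords y i), (fun y => gweight g y / Z).
exists (fun y => if ellipsoid c 1 y then - (gweight g y / Z) else 0).
exists (ellipsoid c 4); split.
- by move=> y; rewrite divr_ge0 ?(ltW Z0) // ltW // gweight_gt0.
- rewrite -mulr_suml ler_pdivrMr //; apply: le_trans tot.
  rewrite [leRHS](bigID (ellipsoid c 4)) /= lerDl.
  by apply: sumr_ge0 => y _; exact/ltW/gweight_gt0.
- move=> y yE.
  have -> : \sum_i l i * (h * coords y i) ^+ 2 =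
            32 * \sum_i h ^+ 2 * l i / 32 * coords y i ^+ 2.
    by rewrite mulr_sumr; apply: eq_bigr => i _; field.
  suff : \sum_i h ^+ 2 * l i / 32 * coords y i ^+ 2 <= 4 by lra.
  apply: le_trans yE; apply: ler_sum => i _.
  by rewrite ler_wpM2r ?sqr_ge0 // /c lerDl ltW.
move=> v v1.
have vi i : `|v i| <= M%:R * h.
  apply: (@le_trans _ _ 1).
    rewrite -(@ler_pXn2r _ 2) ?nnegrE // real_normK ?num_real // expr1n.
    apply: le_trans v1; rewrite (bigD1 i) //= ler_wpDr //.
    by apply: sumr_ge0 => j _; rewrite sqr_ge0.
  apply: le_trans Xh _; rewrite ler_wpM2r ?(ltW h0) // ler_nat.
  by rewrite leq_addl.
have [k hk] := choice (fun i => lattice_round h0 (vi i)).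
pose x : J := [ffun i => k i].
have hx i : h * coords x i = h * centered (k i) by rewrite /coords ffunE.
have hx1 i : `|h * coords x i| <= `|v i| by rewrite hx; have [] := hk i.
have hx2 i : (h * coords x i) ^+ 2 <= v i ^+ 2.
  by rewrite -(real_normK (num_real (v i))) -(real_normK (num_real (h * _))) ler_pXn2r ?nnegrE.
have sx : \sum_i (h * coords x i) ^+ 2 <= 1.
  by apply: le_trans v1; exact: ler_sum.
exists (fun i => h * coords x i); split => //.
  by move=> i; rewrite hx; have [] := hk i.
move=> q s pq.
pose q' y := q (fun i => h * y i).
have pq' : parallelogram q'.
  move=> y z; rewrite /q'.
  have -> : (fun i => h * (y i + z i)) = fun i => h * y i + h * z i.
    by apply/funext => i; rewrite mulrDr.
  have -> : (fun i => h * (y i - z i)) = fun i => h * y i - h * z i.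
    by apply/funext => i; rewrite mulrBr.
  exact: pq.
have xE : ellipsoid c 1 x.
  rewrite /ellipsoid.
  apply: (@le_trans _ _ (\sum_i (h * coords x i) ^+ 2)) => //.
  apply: ler_sum => i _; rewrite exprMn ler_wpM2r ?sqr_ge0 // /c.
  have /andP[_] := l01 i; have := l01 i; move: (l i) => z.
  by move: (h ^+ 2) e1 h20 => hh; nra.
have hM (y : J) : ellipsoid c 1 y ->
    forall i, `|coords x i + coords y i : R| <= M%:R.
  move=> yE i; apply: le_trans (ler_normD _ _) _.
  rewrite /M natrD addrC; apply: lerD; first exact: bound.
  have := hx1 i; rewrite normrM (gtr0_norm h0) => h1.
  have v1i : `|v i| <= 1.
    rewrite -(@ler_pXn2r _ 2) ?nnegrE // real_normK ?num_real // expr1n.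
    apply: le_trans v1; rewrite (bigD1 i) //= ler_wpDr //.
    by apply: sumr_ge0 => j _; rewrite sqr_ge0.
  rewrite -(ler_pM2l h0); apply: le_trans h1 _; apply: le_trans v1i _.
  by rewrite mulrC.
have := gaussian_variational g0 s c0 pq' hM xE; rewrite -/Z => main.
rewrite -/(q' (coords x)) -(ler_pM2l Z0); apply: le_trans main _.
rewrite !mulrDr; apply: lerD; first apply: lerD.
- rewrite -!mulrDr ler_pM2l // lerD2r /g.
  have -> : h ^+ 2 / (2 * b) * \sum_i coords x i ^+ 2 =
    (2 * b)^-1 * \sum_i (h * coords x i) ^+ 2.
    rewrite mulrAC mulrC mulr_sumr; congr (_ * _).
    by apply: eq_bigr => i _; rewrite exprMn.
  by rewrite ler_piMr // invr_ge0 mulr_ge0 // ltW.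
- rewrite mulr_sumr; apply: ler_sum => y _.
  by rewrite !mulrA (mulrAC Z) divff ?mul1r ?gt_eqF // mulrC mulrC.
- rewrite mulr_sumr -sumrN [leRHS](bigID (ellipsoid c 1)) /=.
  rewrite [X in _ <= _ + X]big1 ?addr0; last first.
    by move=> y /negPf ->; rewrite mul0r mulr0.
  apply: ler_sum => y ->.
  by rewrite !mulrA mulrN mulrCA divff ?gt_eqF // mulr1 mulNr.
Qed.

(** * Hilbert space and excess risk *)

Section InnerProduct.
Context {R : realType} {H : completeNormedModType R}.
Variable ip : {dot H for idfun}.
Implicit Types (x y z : H) (p : option nat) (e f : nat -> H).

Lemma ipC x y : ip x y = ip y x.
Proof. by rewrite hermC /= expr0 mul1r. Qed.

Lemma ipZl (a : R) x z : ip (a *: x) z = a * ip x z.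
Proof. by rewrite linearZl. Qed.

Lemma ipZr (a : R) x z : ip z (a *: x) = a * ip z x.
Proof. by rewrite ipC ipZl ipC. Qed.

Lemma ipDl x y z : ip (x + y) z = ip x z + ip y z.
Proof. exact: linearDl. Qed.

Lemma ipBl x y z : ip (x - y) z = ip x z - ip y z.
Proof. exact: linearBl. Qed.

Lemma ipDr x y z : ip z (x + y) = ip z x + ip z y.
Proof. exact: linearDr. Qed.

Lemma ipBr x y z : ip z (x - y) = ip z x - ip z y.
Proof. exact: linearBr. Qed.

Lemma ip0r z : ip z 0 = 0.
Proof. exact: linear0r. Qed.

Lemma ip_combl (I : Type) (r : seq I) (P : pred I) (c : I -> R) (F : I -> H) z :
  ip (\sum_(i <- r | P i) c i *: F i) z = \sum_(i <- r | P i) c i * ip (F i) z.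
Proof. rewrite linear_sumlz; apply: eq_bigr => i _; exact: ipZl. Qed.

Lemma ip_combr (I : Type) (r : seq I) (P : pred I) (c : I -> R) (F : I -> H) z :
  ip z (\sum_(i <- r | P i) c i *: F i) = \sum_(i <- r | P i) c i * ip z (F i).
Proof. by rewrite ipC ip_combl; apply: eq_bigr => i _; rewrite ipC. Qed.

Hypothesis nrm : induces_norm ip.

Lemma ip_ge0 x : 0 <= ip x x.
Proof. by rewrite -nrm exprn_ge0. Qed.

Lemma ip_sqr_le x y : ip x y ^+ 2 <= ip x x * ip y y.
Proof.
have [->|y0] := eqVneq y 0; first by rewrite !ip0r expr0n mulr0.
have yy : 0 < ip y y by rewrite -nrm exprn_gt0 // normr_gt0.
have := ip_ge0 (ip y y *: x - ip x y *: y).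
rewrite ipBl !ipBr /=. rewrite !ipZl !ipZr (ipC y x).
set a := ip x y; set b := ip y y in yy *; set c := ip x x.
have -> : b * (b * c) - b * (a * a) - (a * (b * a) - a * (a * b)) =
          b * (c * b - a ^+ 2) by ring.
by rewrite pmulr_rge0 // subr_ge0.
Qed.

Lemma ip_le_norm x y : `|ip x y| <= `|x| * `|y|.
Proof.
rewrite -(@ler_pXn2r _ 2) ?nnegrE ?mulr_ge0 // real_normK ?num_real //.
by rewrite exprMn !nrm ip_sqr_le.
Qed.

Lemma ip_continuous y : continuous (fun x : H => ip x y : R^o).
Proof.
move=> x; apply/cvgrPdist_lt => e e0.
have y1 : 0 < `|y| + 1 by rewrite ltr_wpDl.
near=> z.
rewrite -ipBl; apply: le_lt_trans (ip_le_norm _ _) _.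
apply: (@le_lt_trans _ _ (`|x - z| * (`|y| + 1))).
  by rewrite ler_wpM2l // lerDl.
rewrite -ltr_pdivlMr //.
near: z; apply: (@cvgr_dist_lt _ _ _ (nbhs x) _ id x cvg_id).
by rewrite divr_gt0.
Unshelve. all: by end_near. Qed.

Definition orthonormal_on (D : pred nat) e : Prop :=
  forall j k, D j -> D k -> ip (e j) (e k) = (j == k)%:R.

Section OrthonormalFamily.
Variables (D : pred nat) (e : nat -> H).
Hypothesis eD : orthonormal_on D e.

Lemma ip_comb_basis N (c : nat -> R) k : D k -> (k < N)%N ->
  ip (\sum_(0 <= j < N | D j) c j *: e j) (e k) = c k.
Proof.
move=> Dk kN; rewrite ip_combl big_mkord (bigD1 (Ordinal kN)) //= eD // eqxx mulr1.
rewrite big1 ?addr0 // => i /andP[Di ik]; rewrite eD //.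
by move: ik; rewrite -val_eqE /= => /negPf ->; rewrite mulr0.
Qed.

(** Completing the square in the coefficients. Taking c_j = <x, e_j> gives Bessel's inequality and
    best approximation; taking x = 0 gives the norm of a combination. *)
Lemma norm_sub_comb N (c : nat -> R) x :
  `|x - \sum_(0 <= j < N | D j) c j *: e j| ^+ 2 =
  `|x| ^+ 2 - \sum_(0 <= j < N | D j) ip x (e j) ^+ 2 +
  \sum_(0 <= j < N | D j) (ip x (e j) - c j) ^+ 2.
Proof.
rewrite !nrm; set s := \sum_(0 <= j < N | D j) c j *: e j.
rewrite ipBl !ipBr /= (ipC s x).
have -> : ip s s = \sum_(0 <= j < N | D j) c j ^+ 2.
  rewrite {2}/s ip_combr big_nat_cond [RHS]big_nat_cond.
  apply: eq_bigr => j /andP[/andP[_ jN] Dj].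
  by rewrite ip_comb_basis // expr2.
have -> : ip x s = \sum_(0 <= j < N | D j) c j * ip x (e j) by rewrite ip_combr.
rewrite -[in RHS]addrA; set A := \sum_(0 <= j < N | D j) c j * _.
have -> : - (\sum_(0 <= j < N | D j) ip x (e j) ^+ 2) +
     \sum_(0 <= j < N | D j) (ip x (e j) - c j) ^+ 2 =
     \sum_(0 <= j < N | D j) c j ^+ 2 - A - A.
  rewrite /A -!sumrN -!big_split /=; apply: eq_bigr => j _; ring.
ring.
Qed.

Lemma bessel N x :
  \sum_(0 <= j < N | D j) ip x (e j) ^+ 2 <= `|x| ^+ 2.
Proof.
rewrite -subr_ge0.
have := norm_sub_comb N (fun j => ip x (e j)) x.
rewrite [X in _ = _ + X]big1 ?addr0; last by move=> *; rewrite subrr expr0n.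
by move=> <-; rewrite exprn_ge0.
Qed.

End OrthonormalFamily.

Lemma sum_below_ler (D : pred nat) (F : nat -> R) m n : (forall j, D j -> 0 <= F j) ->
  (m <= n)%N ->
  \sum_(0 <= j < m | D j) F j <= \sum_(0 <= j < n | D j) F j.
Proof.
move=> F0 mn; rewrite (big_cat_nat _ mn) //= lerDl.
by apply: sumr_ge0.
Qed.

Section Parseval.
Variables (p : option nat) (e : nat -> H).
Hypothesis be : orthonormal_basis ip p e.

Lemma basis_orthonormal : orthonormal_on (below p) e.
Proof. by case: be. Qed.

(** Density gives one finite combination close to x; the Fourier partial sums from its length on are
    at least as close. *)
Lemma parseval x :
  (fun N => \sum_(0 <= j < N | below p j) ip x (e j) ^+ 2) @ \oo --> `|x| ^+ 2.
Proof.
apply/cvgrPdist_le => eps eps0.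
have [_ dn] := be.
have s0 : 0 < Num.sqrt eps by rewrite sqrtr_gt0.
have [z [/= zx [N0 [c zE]]]] : ball x (Num.sqrt eps) `&`
    [set x0 : H | exists N (c : nat -> R),
       x0 = \sum_(0 <= j < N | below p j) c j *: e j] !=set0.
  by apply: dn; [exists x; exact: ballxx | exact: ball_open].
exists N0 => // N /= NN.
rewrite ger0_norm; last by rewrite subr_ge0; exact: bessel basis_orthonormal _ _.
apply: (@le_trans _ _ (`|x - z| ^+ 2)).
  rewrite zE (norm_sub_comb basis_orthonormal).
  apply: (@le_trans _ _ (`|x| ^+ 2 - \sum_(0 <= j < N0 | below p j) ip x (e j) ^+ 2)).
    rewrite lerB // sum_below_ler // => j _; exact: sqr_ge0.
  by rewrite lerDl; apply: sumr_ge0 => j _; exact: sqr_ge0.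
move: zx; rewrite -ball_normE /= => zx.
by rewrite -(sqr_sqrtr (ltW eps0)) ler_pXn2r ?nnegrE ?sqrtr_ge0 // ltW.
Qed.

Lemma parseval_ip x y :
  (fun N => \sum_(0 <= j < N | below p j) ip x (e j) * ip y (e j)) @ \oo --> ip x y.
Proof.
have -> : ip x y = 4^-1 * (`|x + y| ^+ 2 - `|x - y| ^+ 2).
  rewrite !nrm ipBl !ipBr ipDl !ipDr (ipC y x).
  by field.
have -> : (fun N => \sum_(0 <= j < N | below p j) ip x (e j) * ip y (e j)) =
    (fun N => 4^-1 * (\sum_(0 <= j < N | below p j) ip (x + y) (e j) ^+ 2 -
                      \sum_(0 <= j < N | below p j) ip (x - y) (e j) ^+ 2)).
  apply/funext => N; rewrite -sumrB mulr_sumr; apply: eq_bigr => j _.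
  by rewrite ipBl ipDl; field.
by apply: cvgM; [exact: cvg_cst|apply: cvgB; exact: parseval].
Qed.

End Parseval.

(** All eigenvalues of index at least d are replaced by lam_d. Writing the others as excesses over
    lam_d leaves nonnegative coefficients, as [ky_fan] requires. *)
Lemma eigen_form_le p S lam e d x : is_adjoint ip S S ->
  eigenbasis ip p S lam e -> below p d -> 0 <= lam d ->
  ip (S x) x <= \sum_(0 <= a < d) (lam a - lam d) * ip x (e a) ^+ 2 +
                lam d * `|x| ^+ 2.
Proof.
move=> SS [be eS mon] pd l0.
have belowS j : (j <= d)%N -> below p j.
  by case: p pd {be eS mon} => [m|//] /= pd jd; exact: leq_ltn_trans jd pd.
have cv := @parseval_ip _ _ be (S x) x.
rewrite -(cvg_lim _ cv) //; apply: limr_le; first exact: cvgP cv.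
near=> N.
have dN : (d <= N)%N by near: N; exact: nbhs_infty_ge.
under eq_bigr => j pj.
  rewrite (SS x) eS // ipZr -mulrA -expr2; over.
apply: (@le_trans _ _ (\sum_(0 <= a < d) (lam a - lam d) * ip x (e a) ^+ 2 +
   lam d * \sum_(0 <= j < N | below p j) ip x (e j) ^+ 2)); last first.
  rewrite lerD2l ler_wpM2l // bessel //; exact: basis_orthonormal be.
have split_at (F : nat -> R) : \sum_(0 <= j < N | below p j) F j =
    \sum_(0 <= j < d) F j + \sum_(d <= j < N | below p j) F j.
  rewrite (big_cat_nat _ dN) //=; congr (_ + _).
  rewrite big_nat_cond [RHS]big_nat_cond; apply: eq_bigl => j.
  by rewrite andbT andb_idr // => /andP[_ /ltnW]; exact: belowS.
rewrite !split_at mulrDr addrA; apply: lerD.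
  rewrite mulr_sumr -big_split /=; apply: ler_sum => a _.
  by rewrite mulrBl subrK.
rewrite mulr_sumr big_nat_cond [leRHS]big_nat_cond.
apply: ler_sum => j /andP[/andP[dj _] pj].
by rewrite ler_wpM2r ?sqr_ge0 // mon.
Unshelve. all: by end_near. Qed.

(** Ky Fan's maximum principle. After summing over v, the coefficient of lam_a - lam_d >= 0 is the
    squared norm of a projection of e_a, at most 1 by Bessel. Applied to the empirical covariance,
    it expresses the optimality of the estimated projector. *)
Lemma ky_fan p S lam e d v : is_adjoint ip S S ->
  eigenbasis ip p S lam e -> below p d -> 0 <= lam d ->
  orthonormal_on (fun j => j < d)%N v ->
  \sum_(0 <= j < d) ip (S (v j)) (v j) <= \sum_(0 <= a < d) lam a.
Proof.
move=> SS eb pd l0 ov.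
have [be eS mon] := eb.
apply: (@le_trans _ _ (\sum_(0 <= j < d)
   (\sum_(0 <= a < d) (lam a - lam d) * ip (v j) (e a) ^+ 2 + lam d))).
  rewrite big_nat_cond [leRHS]big_nat_cond; apply: ler_sum => j.
  rewrite andbT => /andP[_ jd].
  apply: le_trans (eigen_form_le (v j) SS eb pd l0) _.
  by rewrite nrm ov // eqxx mulr1.
rewrite big_split /= exchange_big /=.
have -> : \sum_(0 <= a < d) lam a =
    \sum_(0 <= a < d) (lam a - lam d) + \sum_(0 <= a < d) lam d.
  by rewrite -big_split /=; apply: eq_bigr => a _; rewrite subrK.
rewrite lerD2r big_nat_cond [leRHS]big_nat_cond; apply: ler_sum => a.
rewrite andbT => /andP[_ ad].
rewrite -mulr_sumr ler_piMr ?subr_ge0 ?mon // 1?ltnW //.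
have := bessel ov d (e a); rewrite nrm.
have pa : below p a by case: p pd {be eS mon eb} => [m|//] /=; exact: ltn_trans.
rewrite (basis_orthonormal be) // eqxx; apply: le_trans.
rewrite le_eqVlt; apply/orP; left; apply/eqP.
rewrite big_nat_cond [RHS]big_nat_cond.
by apply: eq_big => [j|j _]; [rewrite leq0n /=; case: (_ < d)%N|rewrite ipC].
Qed.

Lemma adjointE S : is_adjoint ip S S -> adjoint ip S = S.
Proof.
move=> SS; rewrite /adjoint; case: xgetP => [S' -> |/(_ S)//] hS'.
apply/funext => y; apply/eqP; rewrite -subr_eq0; apply/eqP.
apply/eqP; rewrite -normr_eq0 -sqrf_eq0 nrm ipBr /=.
by rewrite -SS -(hS' _ y) subrr.
Qed.

Lemma projectorE e d x y :
  ip (projector ip e d x) y = \sum_(0 <= j < d) ip (e j) x * ip (e j) y.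
Proof. by rewrite /projector /tensor ip_combl. Qed.

(** * The excess risk as a limit of finite sums *)

Section ExcessRisk.
Variables (p : option nat) (S : H -> H) (lam : nat -> R) (u f : nat -> H) (d : nat).
Hypotheses (SS : is_adjoint ip S S) (eb : eigenbasis ip p S lam u).
Hypotheses (l0 : forall j, below p j -> 0 <= lam j) (pd : below p d).
Hypothesis ff : orthonormal_on (fun j => j < d)%N f.
Variable B : R.
Hypothesis lB : forall N, \sum_(0 <= j < N | below p j) lam j <= B.

(** The diagonal entry <Q u_j, u_j> of the projector Q onto the span of f. *)
Definition overlap j : R := \sum_(0 <= a < d) ip (f a) (u j) ^+ 2.

Lemma below_le j : (j <= d)%N -> below p j.
Proof. by move: pd; case: p => [m|//] /= pd' jd; exact: leq_ltn_trans jd pd'. Qed.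

Lemma overlap01 j : below p j -> 0 <= overlap j <= 1.
Proof.
move=> pj; apply/andP; split; first by apply: sumr_ge0 => a _; exact: sqr_ge0.
have [be _ _] := eb.
have := bessel ff d (u j); rewrite nrm (basis_orthonormal be) // eqxx.
apply: le_trans; rewrite /overlap le_eqVlt; apply/orP; left; apply/eqP.
rewrite big_nat_cond [RHS]big_nat_cond.
by apply: eq_big => [k|k _]; [rewrite leq0n /=; case: (_ < d)%N|rewrite ipC].
Qed.

Let T N := \sum_(0 <= j < N | below p j) lam j * ((j < d)%:R - overlap j).

Lemma excess_riskE : excess_risk ip p S u d f = limn T.
Proof.
rewrite /excess_risk /hs_inner /trace (adjointE SS); congr (lim (_ @ \oo)).
have [be eS _] := eb.
apply/funext => N; apply: eq_bigr => j pj /=.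
rewrite (SS _ (u j)) eS // ipZr ipBl !projectorE; congr (_ * (_ - _)).
case: ltnP => jd.
    rewrite big_mkord (bigD1 (Ordinal jd)) //= (basis_orthonormal be) // eqxx mulr1.
    rewrite big1 ?addr0 // => i ij; rewrite (basis_orthonormal be) //.
      by move: ij; rewrite -val_eqE /= => /negPf ->; rewrite mulr0.
    by apply: below_le; exact/ltnW/ltn_ord.
  rewrite big_nat_cond big1 // => i; rewrite andbT => /andP[_ id].
  have -> : ip (u i) (u j) = 0; last by rewrite mul0r.
  rewrite (basis_orthonormal be) ?ltn_eqF ?(leq_trans id) //.
by apply: below_le; exact: ltnW.
Qed.

Lemma partial_traceE N : (d <= N)%N ->
  T N = \sum_(0 <= j < d) lam j - \sum_(0 <= j < N | below p j) lam j * overlap j.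
Proof.
move=> dN; rewrite /T; under eq_bigr do rewrite mulrBr.
rewrite sumrB; congr (_ - _); rewrite (big_cat_nat _ dN) //=.
rewrite [X in _ + X = _]big_nat_cond [X in _ + X = _]big1; last first.
  by move=> j /andP[/andP[dj _] _]; rewrite ltnNge dj mulr0.
rewrite addr0 big_nat_cond [RHS]big_nat_cond; apply: eq_big => j.
  by rewrite andbT andb_idr // => /andP[_ /ltnW]; exact: below_le.
by move=> /andP[/andP[_ ->] _]; rewrite mulr1.
Qed.

Let TB N : `|T N| <= B.
Proof.
apply: le_trans (ler_norm_sum _ _ _) _; apply: le_trans (lB N).
apply: ler_sum => j pj; rewrite normrM ger0_norm ?l0 // ler_piMr ?l0 //.
have /andP[] := overlap01 pj; rewrite ler_norml.
by case: (j < d)%N => /= a b; apply/andP; split; lra.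
Qed.

(** Monotone only from index d on, where each new term is -lam_j times an overlap; hence the shift
    by d. *)
Let T_shift_noninc : nonincreasing_seq (fun N => T (N + d)%N).
Proof.
move=> m n mn; rewrite !partial_traceE ?leq_addl // lerB // sum_below_ler ?leq_add2r //.
by move=> j pj; rewrite mulr_ge0 ?l0 //; have /andP[] := overlap01 pj.
Qed.

Let T_shift_cvg : cvgn (fun N => T (N + d)%N).
Proof.
apply: nonincreasing_is_cvgn => //; exists (- B) => _ [N _ <-].
by have := TB (N + d)%N; rewrite ler_norml => /andP[].
Qed.

Let T_lim : limn T = limn (fun N => T (N + d)%N).
Proof. by apply/cvg_lim => //; rewrite -(cvg_shiftn d); exact: T_shift_cvg. Qed.

(** A decreasing sequence lies above its limit: the risk can be cut at any N >= d at no cost, and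
    only the empirical side will need a truncation error. *)
Lemma excess_risk_le N : (d <= N)%N -> excess_risk ip p S u d f <=
  \sum_(0 <= j < d) lam j - \sum_(0 <= j < N | below p j) lam j * overlap j.
Proof.
move=> dN; rewrite excess_riskE T_lim -partial_traceE // -(subnK dN).
exact: (nonincreasing_cvgn_ge T_shift_noninc T_shift_cvg).
Qed.

(** Uniform in f, hence in the sample: this is what makes the excess risk integrable. *)
Lemma excess_risk_bounded : `|excess_risk ip p S u d f| <= B.
Proof.
rewrite excess_riskE T_lim ler_norml; apply/andP; split.
  apply: limr_ge; first exact: T_shift_cvg.
  by near=> N; have := TB (N + d)%N; rewrite ler_norml => /andP[].
apply: limr_le; first exact: T_shift_cvg.
by near=> N; have := TB (N + d)%N; rewrite ler_norml => /andP[].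
Unshelve. all: by end_near. Qed.

End ExcessRisk.

End InnerProduct.

(** * Independence and Laplace transforms *)

Section ProductRule.
Context {R : realType} {dT dS : measure_display}.
Context {T : measurableType dT} {S : measurableType dS} (P : probability T R).
Local Open Scope ereal_scope.
Import HBNNSimple.

Lemma integral_mul_comp_nnsfun (G : T -> R) (Y : T -> S) (c : R) (s : {nnsfun S >-> R}) :
  measurable_fun setT G -> (forall t, 0 <= G t)%R ->
  measurable_fun setT Y -> (0 <= c)%R ->
  (forall B, measurable B ->
     \int[P]_t (G t * \1_B (Y t))%:E = c%:E * P (Y @^-1` B)) ->
  \int[P]_t (G t * s (Y t))%:E =
  c%:E * (\sum_(r \in range s) r%:E * P (Y @^-1` (s @^-1` [set r]))).
Proof.
move=> mG G0 mY c0 hB.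
have mI r : measurable_fun setT (fun t => \1_(s @^-1` [set r]) (Y t) : R).
  by apply: measurableT_comp => //; exact: measurable_indic.
transitivity (\sum_(r \in range s)
   \int[P]_t (G t * (r * \1_(s @^-1` [set r]) (Y t)))%:E).
  rewrite -ge0_integral_fsum//.
  - apply: eq_integral => t _; rewrite fsumEFin//; congr EFin.
    by rewrite [in LHS](fimfunE s) mulr_fsumr.
  - by move=> r; apply/measurable_EFinP; do 2 apply: measurable_funM => //.
  - move=> r t _; rewrite lee_fin mulr_ge0 ?G0//.
    by have := nnfun_muleindic_ge0 s r (Y t); rewrite -EFinM lee_fin.
rewrite ge0_mule_fsumr; last first.
  move=> r; have [r0|r0] := leP 0%R r; first by rewrite mule_ge0.
  by rewrite preimage_nnfun0// preimage_set0 measure0 mule0.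
apply: eq_fsbigr => r _.
have [r0|r0] := leP 0%R r; last first.
  rewrite preimage_nnfun0// preimage_set0 measure0 !mule0.
  by rewrite integral0_eq// => t _; rewrite indic0 !mulr0.
under eq_integral do rewrite mulrCA EFinM.
rewrite ge0_integralZl_EFin//.
- by rewrite hB// muleCA.
- by move=> t _; rewrite lee_fin mulr_ge0 ?G0.
- by apply/measurable_EFinP; exact: measurable_funM.
Qed.

Lemma integral_indic_comp (Y : T -> S) B : measurable_fun setT Y -> measurable B ->
  \int[P]_t (\1_B (Y t))%:E = P (Y @^-1` B).
Proof.
move=> mY mB.
have -> : (fun t => (\1_B (Y t))%:E) = EFin \o (\1_(Y @^-1` B) : T -> R).
  by apply/funext => t /=; rewrite !indicE; congr ((_ : bool)%:R%:E).
by rewrite integral_indic ?setIT// -[X in measurable X]setTI; exact: mY.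
Qed.

(** Here c stands for the mean of G. Factorisation against indicators of Y extends to simple
    functions by linearity and to nonnegative functions by monotone convergence. *)
Lemma integral_mul_comp (G : T -> R) (Y : T -> S) (c : R) (g : S -> R) :
  measurable_fun setT G -> (forall t, 0 <= G t)%R ->
  measurable_fun setT Y -> (0 <= c)%R ->
  (forall B, measurable B ->
     \int[P]_t (G t * \1_B (Y t))%:E = c%:E * P (Y @^-1` B)) ->
  measurable_fun setT g -> (forall y, 0 <= g y)%R ->
  \int[P]_t (G t * g (Y t))%:E = c%:E * \int[P]_t (g (Y t))%:E.
Proof.
move=> mG G0 mY c0 hB mg g0.
have mEg : measurable_fun setT (EFin \o g) by exact/measurable_EFinP.
pose f_ := nnsfun_approx measurableT mEg.
have fg y : (EFin \o f_ ^~ y) @ \oo --> (g y)%:E.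
  by apply: cvg_nnsfun_approx => // z _; rewrite lee_fin.
have mfY n : measurable_fun setT (fun t => f_ n (Y t)) by exact: measurableT_comp.
have step n : \int[P]_t (G t * f_ n (Y t))%:E = c%:E * \int[P]_t (f_ n (Y t))%:E.
  rewrite (integral_mul_comp_nnsfun (f_ n) mG G0 mY c0 hB); congr (_ * _).
  (* The case G = 1 of the simple function lemma identifies the finite sum with the integral of
     [f_ n (Y t)]. *)
  have h1 B : measurable B ->
      \int[P]_t (cst 1 t * \1_B (Y t))%:E = 1%:E * P (Y @^-1` B).
    move=> mB; rewrite mul1e; under eq_integral do rewrite mul1r.
    exact: integral_indic_comp.
  rewrite -[LHS]mul1e -(@integral_mul_comp_nnsfun (cst 1%R) Y 1 (f_ n))//.
  by apply: eq_integral => t _; rewrite mul1r.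
transitivity (limn (fun n => \int[P]_t (G t * f_ n (Y t))%:E)).
  rewrite -monotone_convergence//.
  - apply: eq_integral => t _; apply/esym/cvg_lim => //.
    under eq_fun do rewrite EFinM.
    by rewrite EFinM; apply: cvgeZl => //; exact: fg.
  - by move=> n; apply/measurable_EFinP; exact: measurable_funM.
  - by move=> n t _; rewrite lee_fin mulr_ge0 ?G0.
  - by move=> t _ m n mn; rewrite lee_fin ler_wpM2l ?G0//; exact/lefP/nd_nnsfun_approx.
under eq_fun do rewrite step.
apply/cvg_lim => //; apply: cvgeZl => //.
have -> : \int[P]_t (g (Y t))%:E = \int[P]_t (limn (fun n => (f_ n (Y t))%:E)).
  by apply: eq_integral => t _; apply/esym/cvg_lim => //; exact: fg.
apply: cvg_monotone_convergence => //.
- by move=> n; exact/measurable_EFinP.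
- by move=> n t _; rewrite lee_fin.
- by move=> t _ m n mn; rewrite lee_fin; exact/lefP/nd_nnsfun_approx.
Qed.

(** Induction on the number k of factors allowed to be arbitrary, the others being indicators. For k
    = 0 this is independence itself; in the step, factor k is tested against an indicator, where the
    induction hypothesis applies, and [integral_mul_comp] releases it. *)
Lemma integral_prod_independent n (Xs : 'I_n -> T -> S) (h : 'I_n -> S -> R)
    (c : 'I_n -> R) :
  (forall i, measurable_fun setT (Xs i)) ->
  (forall B : 'I_n -> set S, (forall i, measurable (B i)) ->
    P (\bigcap_(i in [set: 'I_n]) (Xs i @^-1` B i)) =
    \prod_(i < n) P (Xs i @^-1` B i)) ->
  (forall i, measurable_fun setT (h i)) -> (forall i y, 0 <= h i y)%R ->
  (forall i, \int[P]_t (h i (Xs i t))%:E = (c i)%:E) ->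
  \int[P]_t (\prod_(i < n) h i (Xs i t))%:E = (\prod_(i < n) c i)%:E.
Proof.
move=> mX ind.
pose indicator (g : S -> R) := exists2 B, measurable B & g = \1_B.
suff claim k : (k <= n)%N -> forall (h : 'I_n -> S -> R) (c : 'I_n -> R),
    (forall i : 'I_n, (k <= i)%N -> indicator (h i)) ->
    (forall i, measurable_fun setT (h i)) -> (forall i y, 0 <= h i y)%R ->
    (forall i, \int[P]_t (h i (Xs i t))%:E = (c i)%:E) ->
    \int[P]_t (\prod_(i < n) h i (Xs i t))%:E = (\prod_(i < n) c i)%:E.
  by apply: (claim n) => // i; rewrite leqNgt ltn_ord.
elim: k => [_|k IH kn] {}h {}c hI mh h0 hc.
  have [B hB] := choice (fun i => let: ex_intro2 B mB e := hI i isT in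
    ex_intro (fun B => measurable B /\ h i = \1_B) B (conj mB e)).
  have -> : (fun t => (\prod_(i < n) h i (Xs i t))%:E) =
      EFin \o (\1_(\bigcap_(i in [set: 'I_n]) (Xs i @^-1` B i)) : T -> R).
    apply/funext => t /=; congr EFin; rewrite indicE.
    have [tB|tB] := boolP (t \in _).
      move: tB; rewrite inE => tB; rewrite big1// => i _.
      by have [_ ->] := hB i; rewrite indicE mem_set//; exact: tB.
    have [i ti] : exists i, ~ B i (Xs i t).
      apply/existsNP => ht; move/negP: tB; apply; rewrite inE => i _; exact: ht.
    by rewrite (bigD1 i)//= (hB i).2 indicE memNset// mul0r.
  rewrite integral_indic//; last first.
    apply: fin_bigcap_measurable => // i _.
    by rewrite -[X in measurable X]setTI; apply: mX => //; have [] := hB i.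
  rewrite setIT; etransitivity; first exact: (ind B (fun i => (hB i).1)).
  rewrite -prodEFin; apply: eq_bigr => i _.
  have [mB e] := hB i.
  by rewrite -hc e integral_indic_comp.
pose k' := Ordinal kn.
pose G t := (\prod_(i < n | i != k') h i (Xs i t))%R.
have E t : (\prod_(i < n) h i (Xs i t))%R = (G t * h k' (Xs k' t))%R.
  by rewrite (bigD1 k')//= mulrC.
under eq_integral do rewrite E.
rewrite (bigD1 k')//= mulrC EFinM -hc.
apply: integral_mul_comp => //.
- have -> : G = fun t => (\prod_(i < n) if i != k' then h i (Xs i t) else 1)%R.
    by apply/funext => t; rewrite /G big_mkcond.
  by apply: measurable_prod => i _; case: (i != k') => //; exact: measurableT_comp.
- by move=> t; apply: prodr_ge0.
- apply: prodr_ge0 => i _; rewrite -lee_fin -hc; apply: integral_ge0 => t _.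
  by rewrite lee_fin.
move=> B mB.
pose h' i := if i == k' then \1_B else h i.
pose c' i := if i == k' then fine (P (Xs k' @^-1` B)) else c i.
have mYB : measurable (Xs k' @^-1` B) by rewrite -[X in measurable X]setTI; exact: mX.
have := IH (ltnW kn) h' c'.
have Eh t : (\prod_(i < n) h' i (Xs i t))%R = (G t * \1_B (Xs k' t))%R.
  rewrite (bigD1 k')//= /h' eqxx mulrC; congr (_ * _)%R.
  by apply: eq_bigr => i /negPf ->.
have Ec : (\prod_(i < n) c' i =
    (\prod_(i < n | i != k') c i) * fine (P (Xs k' @^-1` B)))%R.
  rewrite (bigD1 k')//= /c' eqxx mulrC; congr (_ * _)%R.
  by apply: eq_bigr => i /negPf ->.
under eq_integral do rewrite Eh.
rewrite Ec EFinM fineK ?fin_num_measure//; apply.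
- move=> i ki; rewrite /h'; case: eqVneq => [_|ik]; first by exists B.
  by apply: hI; rewrite ltn_neqAle ki andbT eq_sym -(inj_eq val_inj) in ik *.
- move=> i; rewrite /h'; case: eqVneq => // _; exact: measurable_indic.
- by move=> i y; rewrite /h'; case: eqVneq => // _; rewrite indicE.
- move=> i; rewrite /h' /c'; case: eqVneq => [->|//].
  by rewrite integral_indic_comp// fineK ?fin_num_measure.
Qed.

End ProductRule.

(** * Bounds on means and sub-exponential Laplace transforms *)

Section MeanBounds.
Context {R : realType} {dT : measure_display} {T : measurableType dT}.
Variable P : probability T R.
Implicit Types f g : T -> R.

Lemma integral_prob_cst (c : \bar R) : (\int[P]_t c = c)%E.
Proof. by rewrite integral_cst//= probability_setT mule1. Qed.

Definition has_mean f (m : R) : Prop :=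
  P.-integrable setT (EFin \o f) /\ (\int[P]_t (f t)%:E = m%:E)%E.

(* An upper bound on the mean that makes sense without measurability of [f]. *)
Definition mean_le f (B : R) : Prop :=
  exists g m, [/\ has_mean g m, forall t, f t <= g t & m <= B].

Lemma has_mean_cst c : has_mean (fun=> c) c.
Proof.
split.
  exact: finite_measure_integrable_cst.
exact: integral_prob_cst.
Qed.

Lemma has_meanD f g a b : has_mean f a -> has_mean g b ->
  has_mean (fun t => f t + g t) (a + b).
Proof.
move=> [fi fe] [gi ge]; split.
  rewrite (_ : _ \o _ = (EFin \o f) \+ (EFin \o g))%E //.
  exact: integrableD.
under eq_integral do rewrite EFinD.
by rewrite integralD// fe ge.
Qed.

Lemma has_meanZ f a c : has_mean f a -> has_mean (fun t => c * f t) (c * a).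
Proof.
move=> [fi fe]; split.
  rewrite (_ : _ \o _ = (fun t => c%:E * (EFin \o f) t))%E //.
  exact: integrableZl.
by under eq_integral do rewrite EFinM; rewrite integralZl// fe.
Qed.

Lemma has_mean_sum (I : Type) (r : seq I) (Q : pred I) (F : I -> T -> R) (m : I -> R) :
  (forall i, Q i -> has_mean (F i) (m i)) ->
  has_mean (fun t => \sum_(i <- r | Q i) F i t) (\sum_(i <- r | Q i) m i).
Proof.
move=> h; elim: r => [|i r IH].
  by rewrite big_nil; under eq_fun do rewrite big_nil; exact: has_mean_cst.
rewrite big_cons; under eq_fun do rewrite big_cons.
by case: ifP => Qi //; apply: has_meanD => //; exact: h.
Qed.

Lemma ge0_has_mean f B : measurable_fun setT f -> (forall t, 0 <= f t) ->
  (\int[P]_t (f t)%:E <= B%:E)%E -> exists2 m, has_mean f m & 0 <= m <= B.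
Proof.
move=> mf f0 fB.
have i0 : (0 <= \int[P]_t (f t)%:E)%E by apply: integral_ge0 => t _; rewrite lee_fin.
have ifin : (\int[P]_t (f t)%:E)%E \is a fin_num.
  by rewrite ge0_fin_numE// (le_lt_trans fB)// ltry.
exists (fine (\int[P]_t (f t)%:E)%E); last first.
  by rewrite fine_ge0//= -lee_fin fineK.
split; last by rewrite fineK.
apply/integrableP; split; first exact/measurable_EFinP.
under eq_integral do rewrite /= ger0_norm//.
by rewrite (le_lt_trans fB)// ltry.
Qed.

Lemma mean_le_of f m : has_mean f m -> mean_le f m.
Proof. by move=> h; exists f, m. Qed.

Lemma mean_le_ge0 f B : measurable_fun setT f -> (forall t, 0 <= f t) ->
  (\int[P]_t (f t)%:E <= B%:E)%E -> mean_le f B.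
Proof.
move=> mf f0 fB; have [m hm /andP[_ mB]] := ge0_has_mean mf f0 fB.
by exists f, m.
Qed.

Lemma mean_leW f g a b : (forall t, f t <= g t) -> a <= b ->
  mean_le g a -> mean_le f b.
Proof.
move=> fg ab [h [m [hm gh ma]]]; exists h, m; split => //.
  by move=> t; exact: le_trans (fg t) (gh t).
exact: le_trans ab.
Qed.

Lemma mean_leD f g a b : mean_le f a -> mean_le g b ->
  mean_le (fun t => f t + g t) (a + b).
Proof.
move=> [f' [m [hm fm ma]]] [g' [k [hk gk kb]]].
exists (fun t => f' t + g' t), (m + k); split.
- exact: has_meanD.
- by move=> t; exact: lerD.
- exact: lerD.
Qed.

Lemma mean_leZ f a c : 0 <= c -> mean_le f a -> mean_le (fun t => c * f t) (c * a).
Proof.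
move=> c0 [f' [m [hm fm ma]]]; exists (fun t => c * f' t), (c * m); split.
- exact: has_meanZ.
- by move=> t; exact: ler_wpM2l.
- exact: ler_wpM2l.
Qed.

Lemma mean_le_cst c : mean_le (fun=> c) c.
Proof. by apply: mean_le_of; exact: has_mean_cst. Qed.

Lemma mean_le_sum (I : Type) (r : seq I) (Q : pred I) (F : I -> T -> R) (m : I -> R) :
  (forall i, Q i -> mean_le (F i) (m i)) ->
  mean_le (fun t => \sum_(i <- r | Q i) F i t) (\sum_(i <- r | Q i) m i).
Proof.
move=> h; elim: r => [|i r IH].
  by rewrite big_nil; under eq_fun do rewrite big_nil; exact: mean_le_cst.
rewrite big_cons; under eq_fun do rewrite big_cons.
by case: ifP => Qi //; apply: mean_leD => //; exact: h.
Qed.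

Lemma integral_mean_le f B : P.-integrable setT (EFin \o f) -> mean_le f B ->
  (\int[P]_t (f t)%:E <= B%:E)%E.
Proof.
move=> fi [g [m [[gi gm] fg mB]]].
apply: (@le_trans _ _ m%:E); last by rewrite lee_fin.
by rewrite -gm; apply: le_integral => // t _; rewrite lee_fin.
Qed.

(* AM-GM: sqrt(W) <= W / (2a) + a / 2. *)
Lemma mean_le_sqrt f a : 0 < a -> (forall t, 0 <= f t) -> mean_le f (a ^+ 2) ->
  mean_le (fun t => Num.sqrt (f t)) a.
Proof.
move=> a0 f0 hf.
have h : mean_le (fun t => (2 * a)^-1 * f t + a / 2) ((2 * a)^-1 * a ^+ 2 + a / 2).
  apply: mean_leD; last exact: mean_le_cst.
  by apply: mean_leZ => //; rewrite invr_ge0 mulr_ge0 // ltW.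
apply: mean_leW h.
  move=> t; rewrite -{2}(sqr_sqrtr (f0 t)); move: (Num.sqrt _) => x.
  have -> : (2 * a)^-1 * x ^+ 2 + a / 2 = x + (x - a) ^+ 2 / (2 * a).
    by field; exact: lt0r_neq0.
  by rewrite lerDl divr_ge0 ?sqr_ge0 // mulr_ge0 // ltW.
by rewrite le_eqVlt; apply/orP; left; apply/eqP; field; exact: lt0r_neq0.
Qed.

(** Reduces to (1 - z + z^2) (1 + z/2)^2 >= 1, whose expansion has no linear term and only
    nonnegative coefficients. *)
Lemma expRN_le (z : R) : 0 <= z -> expR (- z) <= 1 - z + z ^+ 2.
Proof.
move=> z0; have h : 1 + z / 2 <= expR (z / 2) by apply: expR_ge1Dx.
have e : expR z = expR (z / 2) ^+ 2 by rewrite -expRM_natl; congr expR; lra.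
rewrite expRN -[leLHS]mul1r ler_pdivrMr ?expR_gt0 // e.
move: (expR (z / 2)) h => y h.
have y2 : (1 + z / 2) ^+ 2 <= y ^+ 2 by rewrite ler_pXn2r ?nnegrE //; lra.
have p0 : 0 <= 1 - z + z ^+ 2 by nra.
apply: (@le_trans _ _ ((1 - z + z ^+ 2) * (1 + z / 2) ^+ 2)); last exact: ler_wpM2l.
have -> : (1 - z + z ^+ 2) * (1 + z / 2) ^+ 2 =
   1 + z ^+ 2 / 4 + 3 * z ^+ 3 / 4 + z ^+ 4 / 4 by field.
have : 0 <= z ^+ 2 by exact: exprn_ge0.
have : 0 <= z ^+ 3 by exact: exprn_ge0.
have : 0 <= z ^+ 4 by exact: exprn_ge0.
lra.
Qed.

Lemma geometric_half (q : R) k : 0 <= q <= 1 / 2 ->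
  \sum_(0 <= i < k) q ^+ i <= 2.
Proof.
move=> /andP[q0 q2]; rewrite big_mkord.
have := subrX1 q k; set s := \sum_(i < k) q ^+ i => e.
have qk : 0 <= q ^+ k by exact: exprn_ge0.
have s0 : 0 <= s by apply: sumr_ge0 => i _; exact: exprn_ge0.
by nra.
Qed.

Section SubExponential.
Variables (Z : T -> R) (s b : R).
Hypotheses (mZ : measurable_fun setT Z) (Z0 : forall t, 0 <= Z t).
Hypotheses (Zs : (\int[P]_t (Z t)%:E = s%:E)%E) (b0 : 0 <= b).
Hypothesis Zm : forall k, (0 < k)%N ->
  (\int[P]_t (Z t ^+ k)%:E <= (b ^+ k * k`!%:R)%:E)%E.

Let mZk k : measurable_fun setT (fun t => (Z t ^+ k)%:E).
Proof. by apply/measurable_EFinP; exact: measurable_funX. Qed.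

(** Term by term in the exponential series: the moment bound cancels the factorials, and the terms
    from order 2 on are dominated by a geometric series of ratio th b <= 1/2. *)
Lemma mgf_pos th : 0 <= th -> th * b <= 1 / 2 ->
  (\int[P]_t (expR (th * Z t))%:E <= (1 + th * s + 2 * (th * b) ^+ 2)%:E)%E.
Proof.
move=> th0 thb.
pose F k t : R := \sum_(0 <= i < k) (i`!%:R^-1 * th ^+ i) * Z t ^+ i.
have c0 i : 0 <= i`!%:R^-1 * th ^+ i by rewrite mulr_ge0 ?invr_ge0 ?exprn_ge0.
have mF k : measurable_fun setT (fun t => (F k t)%:E).
  apply/measurable_EFinP; apply: measurable_sum => i.
  by apply: measurable_funM => //; exact: measurable_funX.
have FE t : (fun k => (F k t)%:E) @ \oo --> (expR (th * Z t))%:E.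
  apply: cvg_EFin; first by near=> k.
  have -> : fine \o (fun k => (F k t)%:E) = series (exp_coeff (th * Z t)).
    apply/funext => k /=; apply: eq_bigr => i _.
    by rewrite /exp_coeff /= exprMn [RHS]mulrC mulrA.
  exact: is_cvg_series_exp_coeff.
have -> : (\int[P]_t (expR (th * Z t))%:E =
    \int[P]_t limn (fun k => (F k t)%:E))%E.
  by apply: eq_integral => t _; apply/esym/cvg_lim => //; exact: FE.
rewrite monotone_convergence //; last 2 first.
- by move=> k t _; rewrite lee_fin; apply: sumr_ge0 => i _; rewrite mulr_ge0 ?exprn_ge0.
- move=> t _ k l kl; rewrite lee_fin /F (big_cat_nat _ kl) //= lerDl.
  by apply: sumr_ge0 => i _; rewrite mulr_ge0 ?exprn_ge0.
apply: lime_le.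
  apply: ereal_nondecreasing_is_cvgn => k l kl; apply: ge0_le_integral => //.
  - by move=> t _; rewrite lee_fin; apply: sumr_ge0 => i _; rewrite mulr_ge0 ?exprn_ge0.
  - move=> t _; rewrite lee_fin /F (big_cat_nat _ kl) //= lerDl.
    by apply: sumr_ge0 => i _; rewrite mulr_ge0 ?exprn_ge0.
exists 2%N => // -[//|[//|k]] _ /=.
have -> : (\int[P]_t (F k.+2 t)%:E =
  \sum_(0 <= i < k.+2) (i`!%:R^-1 * th ^+ i)%:E * \int[P]_t (Z t ^+ i)%:E)%E.
  rewrite /F; under eq_integral do rewrite -sumEFin.
  rewrite ge0_integral_sum //.
  - apply: eq_bigr => i _; under eq_integral do rewrite EFinM.
    by rewrite ge0_integralZl_EFin // => t _; rewrite lee_fin exprn_ge0.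
  - by move=> i; apply/measurable_EFinP; apply: measurable_funM => //; exact: measurable_funX.
  - by move=> i t _; rewrite lee_fin mulr_ge0 ?exprn_ge0.
rewrite big_nat_recl // big_nat_recl //= fact0 expr0 invr1 mulr1 mul1e.
rewrite ?fact0 ?factS ?muln1 ?invr1 ?mul1r ?expr1.
under eq_integral do rewrite expr0.
rewrite integral_prob_cst.
under eq_integral do rewrite expr1.
rewrite Zs -EFinM EFinD EFinD -addeA; apply: leeD => //; apply: leeD => //.
apply: (@le_trans _ _ (\sum_(0 <= i < k) ((th * b) ^+ i.+2)%:E)%E).
  apply: lee_sum => i _.
  apply: (@le_trans _ _ ((i.+2`!%:R^-1 * th ^+ i.+2)%:E * (b ^+ i.+2 * i.+2`!%:R)%:E)%E).
    by rewrite lee_wpmul2l // ?lee_fin // Zm.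
  rewrite -EFinM lee_fin exprMn le_eqVlt; apply/orP; left; apply/eqP.
  rewrite mulrACA -mulrA [X in _ * X]mulrC mulrA mulrAC mulrC.
  have f0 : i.+2`!%:R != 0 :> R by rewrite pnatr_eq0 -lt0n fact_gt0.
  by field.
rewrite sumEFin lee_fin.
have -> : \sum_(0 <= i < k) (th * b) ^+ i.+2 =
    (th * b) ^+ 2 * \sum_(0 <= i < k) (th * b) ^+ i.
  by rewrite mulr_sumr; apply: eq_bigr => i _; rewrite -exprD.
rewrite mulrC ler_wpM2r ?sqr_ge0 // geometric_half // thb andbT.
by rewrite mulr_ge0.
Unshelve. all: by end_near. Qed.

(** For negative arguments the second moment suffices, so th is not restricted. *)
Lemma mgf_neg th : 0 <= th ->
  (\int[P]_t (expR (- (th * Z t)))%:E <= (1 - th * s + 2 * (th * b) ^+ 2)%:E)%E.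
Proof.
move=> th0.
(* The linear term is moved to the left so that only nonnegative functions are integrated. *)
have : (\int[P]_t (expR (- (th * Z t)))%:E + (th * s)%:E <=
    (1 + 2 * (th * b) ^+ 2)%:E)%E.
  rewrite EFinM -Zs -ge0_integralZl_EFin //; last 2 first.
  - by move=> t _; rewrite lee_fin.
  - exact/measurable_EFinP.
  rewrite -ge0_integralD //; last 3 first.
  - apply/measurable_EFinP; apply: measurableT_comp => //.
    by apply: measurableT_comp => //; exact: measurable_funM.
  - by move=> t _; rewrite -EFinM lee_fin mulr_ge0.
  - by under eq_fun do rewrite -EFinM; apply/measurable_EFinP; exact: measurable_funM.
  apply: (@le_trans _ _ (\int[P]_t (1%:E + (th ^+ 2)%:E * (Z t ^+ 2)%:E))%E).
    apply: ge0_le_integral => //.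
    - by move=> t _; rewrite -EFinM -EFinD lee_fin addr_ge0 ?expR_ge0 ?mulr_ge0.
    - apply/measurable_EFinP => /=; apply: measurable_funD; last exact: measurable_funM.
      by apply: measurableT_comp => //; apply: measurableT_comp => //; exact: measurable_funM.
    - by apply/measurable_EFinP => /=; apply: measurable_funD => //;
        apply: measurable_funM => //; exact: measurable_funX.
    - move=> t _; rewrite -!EFinM -!EFinD lee_fin -exprMn.
      by have := expRN_le (mulr_ge0 th0 (Z0 t)); lra.
  rewrite ge0_integralD //; last 2 first.
  - by move=> t _; rewrite -EFinM lee_fin mulr_ge0 ?sqr_ge0.
  - by under eq_fun do rewrite -EFinM; apply/measurable_EFinP;
      apply: measurable_funM => //; exact: measurable_funX.
  rewrite integral_prob_cst EFinD; apply: leeD => //.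
  rewrite ge0_integralZl_EFin ?sqr_ge0 //; last by move=> t _; rewrite lee_fin exprn_ge0.
  apply: (@le_trans _ _ ((th ^+ 2)%:E * (b ^+ 2 * 2`!%:R)%:E)%E).
    by rewrite lee_wpmul2l ?lee_fin ?sqr_ge0 // Zm.
  have -> : 2`!%:R = 2 :> R by [].
  by rewrite -EFinM lee_fin; lra.
by rewrite -leeBrDr // -EFinB => /le_trans; apply; rewrite lee_fin; lra.
Qed.

Lemma sub_exponential_mgf th : `|th| * b <= 1 / 2 ->
  (\int[P]_t (expR (th * (Z t - s)))%:E <= (expR (2 * (th * b) ^+ 2))%:E)%E.
Proof.
move=> thb.
have mE : measurable_fun setT (fun t => (expR (th * Z t))%:E).
  apply/measurable_EFinP; apply: measurableT_comp => //; exact: measurable_funM.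
have -> : (\int[P]_t (expR (th * (Z t - s)))%:E =
    (expR (- (th * s)))%:E * \int[P]_t (expR (th * Z t))%:E)%E.
  rewrite -ge0_integralZl_EFin ?expR_ge0 //.
  by apply: eq_integral => t _; rewrite -EFinM -expRD; congr (expR _)%:E; ring.
apply: (@le_trans _ _ ((expR (- (th * s)))%:E *
    (1 + th * s + 2 * (th * b) ^+ 2)%:E)%E).
  rewrite lee_wpmul2l ?lee_fin ?expR_ge0 //.
  have [th0|th0] := leP 0 th.
    by apply: mgf_pos => //; rewrite -[th]ger0_norm.
  have := mgf_neg (ltW (_ : 0 < - th)); rewrite oppr_gt0 => /(_ th0).
  under eq_integral do rewrite mulNr opprK.
  by move=> /le_trans; apply; rewrite lee_fin; nra.
rewrite -EFinM lee_fin.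
apply: (@le_trans _ _ (expR (- (th * s)) * expR (th * s + 2 * (th * b) ^+ 2))).
  by rewrite ler_wpM2l ?expR_ge0 // -addrA; exact: expR_ge1Dx.
by rewrite -expRD addKr.
Qed.

End SubExponential.

End MeanBounds.

(** * Sub-Gaussian moments and the averaged squares of the sample *)

Section Sample.
Context {R : realType} {H : completeNormedModType R}.
Variable ip : {dot H for idfun}.
Hypothesis nrm : induces_norm ip.
Context {dT : measure_display} {T : measurableType dT} (P : probability T R).
Local Notation S := (g_sigma_algebraType (@open H)).

Lemma continuous_measurable_borel (f : H -> R) : continuous f ->
  measurable_fun [set: S] (f : S -> R).
Proof.
move=> /continuousP cf mD; apply: (measurability _ (RGenOpens.measurableE R)) => //.
move=> _ [_ [a [b ->] <-]]; rewrite setTI.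
by apply: sub_sigma_algebra; apply: cf; exact: interval_open.
Qed.

Lemma measurable_ip y : measurable_fun [set: S] ((fun x : H => ip x y) : S -> R).
Proof. apply: continuous_measurable_borel; exact: ip_continuous. Qed.

Lemma measurable_norm : measurable_fun [set: S] ((fun x : H => `|x|) : S -> R).
Proof. apply: continuous_measurable_borel; exact: norm_continuous. Qed.

Lemma same_law_integral (X Y : T -> H) (h : H -> R) :
  random_vector X -> random_vector Y -> same_law P X Y ->
  measurable_fun [set: S] (h : S -> R) -> (forall x, 0 <= h x) ->
  (\int[P]_t (h (X t))%:E = \int[P]_t (h (Y t))%:E)%E.
Proof.
move=> mX mY XY mh h0.
have mE : measurable_fun [set: S] ((EFin \o h) : S -> \bar R) by exact/measurable_EFinP.
have E (Z : T -> H) : random_vector Z ->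
    (\int[P]_t (h (Z t))%:E = \int[pushforward P (Z : T -> S)]_x (h x)%:E)%E.
  move=> mZ; have := @ge0_integral_pushforward _ _ T S _ (Z : T -> S) mZ P setT _
    measurableT mE.
  by rewrite preimage_setT => -> // x _; rewrite lee_fin.
by rewrite (E _ mX) (E _ mY); apply: eq_measure_integral => B mB _; exact: XY.
Qed.

Section Moments.
Variables (X : T -> H) (Sigma : H -> H) (C1 : R).
Hypotheses (mX : random_vector X) (cov : is_covariance ip P X Sigma).
Hypothesis sg : sub_gaussian ip P X C1.

Definition form y : R := ip (Sigma y) y.

Lemma covariance_integral x y :
  (\int[P]_t (ip (X t) x * ip (X t) y)%:E = (ip (Sigma x) y)%:E)%E.
Proof.
have [_ _ /(_ y)] := cov x; rewrite unlock => <-.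
by apply: eq_integral => t _; rewrite /tensor ipZl.
Qed.

Lemma covariance_adjoint : is_adjoint ip Sigma Sigma.
Proof.
move=> x y; apply: EFin_inj; rewrite (ipC _ x) -!covariance_integral.
by apply: eq_integral => t _; rewrite mulrC.
Qed.

Lemma form_integral y : (\int[P]_t (ip (X t) y ^+ 2)%:E = (form y)%:E)%E.
Proof. by rewrite -covariance_integral; apply: eq_integral => t _; rewrite expr2. Qed.

Lemma form_ge0 y : 0 <= form y.
Proof.
by rewrite -lee_fin -form_integral; apply: integral_ge0 => t _; rewrite lee_fin sqr_ge0.
Qed.

(** [scale * form y] is the sub-exponential parameter of <X, y>^2: the moment of order 2k of <X, y>
    is at most (2 C1^2 form y)^k k^k, and k^k <= e^k k!. *)
Definition scale : R := 2 * expR 1 * C1 ^+ 2.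

Lemma scale_ge0 : 0 <= scale.
Proof. by rewrite mulr_ge0 ?sqr_ge0 // mulr_ge0 // expR_ge0. Qed.

(** A single term of the series of exp k, namely k^k / k!, is at most e^k. *)
Lemma expn_le_fact k : (0 < k)%N -> k%:R ^+ k <= expR 1 ^+ k * k`!%:R :> R.
Proof.
case: k => // k _.
have := expR_ge1Dxn k (ler0n R k.+1).
rewrite -[X in expR X](mulr1) expRM_natl => h.
rewrite -ler_pdivrMr ?ltr0n ?fact_gt0 //; apply: le_trans h.
by rewrite lerDr.
Qed.

Lemma sub_gaussian_moment y k : (0 < k)%N ->
  (\int[P]_t ((ip (X t) y ^+ 2) ^+ k)%:E <= ((scale * form y) ^+ k * k`!%:R)%:E)%E.
Proof.
move=> k0; have [_ /(_ y)] := sg; rewrite unlock.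
set m := (k.*2)%N => sup.
have m0 : (0 < m)%N by rewrite /m double_gt0.
have mR0 : (0 : R) < m%:R by rewrite ltr0n.
have mN0 : m%:R != 0 :> R by exact: lt0r_neq0.
set I := (\int[P]_t (`|ip (X t) y| ^+ m)%:E)%E.
have -> : (\int[P]_t ((ip (X t) y ^+ 2) ^+ k)%:E)%E = I.
  apply: eq_integral => t _; congr EFin.
  by rewrite -real_normK ?num_real // -exprM /m -mul2n.
have hm : ((m%:R `^ (- 2^-1))%:E * I `^ (m%:R^-1) <=
    C1%:E * (\int[P]_t (ip (X t) y ^+ 2)%:E) `^ (2^-1))%E.
  by apply: le_trans sup; apply: ereal_sup_ubound; exists m.
move: hm; rewrite form_integral poweR_EFin -EFinM => hm.
have I0 : (0 <= I)%E by apply: integral_ge0 => t _; rewrite lee_fin exprn_ge0.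
have mp : 0 < m%:R `^ (- 2^-1) :> R by exact: powR_gt0.
(* Finiteness follows from the sub-Gaussian inequality itself: its right-hand side is finite, and an
   infinite moment would make the left one infinite. *)
have Ifin : I \is a fin_num.
  rewrite ge0_fin_numE // ltNge leye_eq; apply/eqP => Ioo.
  by move: hm; rewrite Ioo poweRyr ?invr_eq0 // gt0_muley ?lte_fin //.
move: hm; rewrite -(fineK Ifin) poweR_EFin -EFinM !lee_fin.
set r := fine I; have r0 : 0 <= r by exact: fine_ge0.
rewrite powR12_sqrt ?form_ge0 // powRN powR12_sqrt ?ler0n //.
set s := Num.sqrt m%:R; set w := Num.sqrt (form y); set z := r `^ _.
have s0 : 0 < s by rewrite sqrtr_gt0.
have z0 : 0 <= z by exact: powR_ge0.
rewrite ler_pdivrMl // => hz.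
have -> : r = z ^+ m by rewrite -powR_mulrn // -powRrM mulVf // powRr1.
apply: (@le_trans _ _ ((s * (C1 * w)) ^+ m)).
  by rewrite ler_pXn2r ?nnegrE //; exact: le_trans hz.
have -> : (s * (C1 * w)) ^+ m = (2 * C1 ^+ 2 * form y) ^+ k * k%:R ^+ k.
  rewrite /m -mul2n exprM -exprMn; congr (_ ^+ _).
  rewrite !exprMn !sqr_sqrtr ?form_ge0 ?ler0n //.
  by rewrite /m -mul2n natrM; ring.
have -> : (scale * form y) ^+ k = (2 * C1 ^+ 2 * form y) ^+ k * expR 1 ^+ k.
  by rewrite -exprMn /scale; congr (_ ^+ _); ring.
rewrite -[leRHS]mulrA ler_wpM2l ?expn_le_fact //.
by rewrite exprn_ge0 // mulr_ge0 ?form_ge0 // mulr_ge0 ?sqr_ge0.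
Qed.

Lemma sub_gaussian_mgf y th : `|th| * (scale * form y) <= 1 / 2 ->
  (\int[P]_t (expR (th * (ip (X t) y ^+ 2 - form y)))%:E <=
   (expR (2 * (th * (scale * form y)) ^+ 2))%:E)%E.
Proof.
move=> h; apply: (@sub_exponential_mgf _ _ _ P (fun t => ip (X t) y ^+ 2)) => //.
- apply: measurable_funX; exact: (measurableT_comp (measurable_ip y) mX).
- by move=> t; exact: sqr_ge0.
- exact: form_integral.
- by rewrite mulr_ge0 ?scale_ge0 ?form_ge0.
- by move=> k; exact: sub_gaussian_moment.
Qed.

Section Copies.
Variables (n : nat) (Xs : 'I_n -> T -> H).
Hypotheses (n0 : (1 <= n)%N) (iid : iid_copies P X Xs).

Definition dev y t : R := n%:R^-1 * \sum_(i < n) ip (Xs i t) y ^+ 2 - form y.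

Let mXs i : random_vector (Xs i). Proof. by case: iid. Qed.
Let lawXs i : same_law P (Xs i) X. Proof. by case: iid. Qed.
Let nR : (n%:R : R) != 0. Proof. by rewrite pnatr_eq0 -lt0n. Qed.

Lemma measurable_copy_ip i y : measurable_fun setT (fun t => ip (Xs i t) y).
Proof. exact: (measurableT_comp (measurable_ip y) (mXs i)). Qed.

Lemma has_mean_copy_ip i y : has_mean P (fun t => ip (Xs i t) y ^+ 2) (form y).
Proof.
have E : (\int[P]_t (ip (Xs i t) y ^+ 2)%:E = (form y)%:E)%E.
  rewrite -form_integral; apply: (same_law_integral (h := fun x => ip x y ^+ 2)) => //.
    by apply: measurable_funX; exact: measurable_ip.
  by move=> x; exact: sqr_ge0.
have [|||m [fi fe] _] := @ge0_has_mean _ _ _ P (fun t => ip (Xs i t) y ^+ 2) (form y).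
- by apply: measurable_funX; exact: measurable_copy_ip.
- by move=> t; exact: sqr_ge0.
- by rewrite E.
by split.
Qed.

Lemma has_mean_copy_norm i (M : R) : (\int[P]_t (`|X t| ^+ 2)%:E = M%:E)%E ->
  has_mean P (fun t => `|Xs i t| ^+ 2) M.
Proof.
move=> XM.
have E : (\int[P]_t (`|Xs i t| ^+ 2)%:E = M%:E)%E.
  rewrite -XM; apply: (same_law_integral (h := fun x => `|x| ^+ 2)) => //.
  by apply: measurable_funX; exact: measurable_norm.
have [|||m [fi fe] _] := @ge0_has_mean _ _ _ P (fun t => `|Xs i t| ^+ 2) M.
- by apply: measurable_funX; exact: (measurableT_comp measurable_norm (mXs i)).
- by move=> t; exact: sqr_ge0.
- by rewrite E.
by split.
Qed.

Lemma has_mean_dev y : has_mean P (dev y) 0.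
Proof.
have -> : 0 = n%:R^-1 * (\sum_(i < n) form y) + - form y :> R.
  by rewrite sumr_const card_ord -[form y *+ n]mulr_natl mulKf ?subrr.
apply: has_meanD; last exact: has_mean_cst.
by apply: has_meanZ; apply: has_mean_sum => i _; exact: has_mean_copy_ip.
Qed.

Lemma mgf_dev y th : `|th| * (scale * form y) <= 1 / 2 ->
  mean_le P (fun t => expR (th * n%:R * dev y t))
    (expR (2 * n%:R * (th * (scale * form y)) ^+ 2)).
Proof.
move=> h; pose F (x : H) : R := expR (th * (ip x y ^+ 2 - form y)).
have mF : measurable_fun [set: S] (F : S -> R).
  apply: measurableT_comp => //; apply: measurable_funM => //.
  apply: measurable_funB => //; apply: measurable_funX; exact: measurable_ip.
have F0 x : 0 <= F x by exact: expR_ge0.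
have mFX i : measurable_fun setT (fun t => F (Xs i t)).
  exact: (measurableT_comp mF (mXs i)).
pose B := expR (2 * (th * (scale * form y)) ^+ 2).
have FB i : (\int[P]_t (F (Xs i t))%:E <= B%:E)%E.
  by rewrite (same_law_integral (mXs i) mX (lawXs i)) // sub_gaussian_mgf.
have [c hc] := choice (fun i => let: ex_intro2 c a b :=
  ge0_has_mean (mFX i) (fun t => F0 (Xs i t)) (FB i) in
  ex_intro (fun c => has_mean P (fun t => F (Xs i t)) c /\ 0 <= c <= B) c (conj a b)).
have prodE t : expR (th * n%:R * dev y t) = \prod_(i < n) F (Xs i t).
  rewrite -expR_sum; congr expR.
  rewrite -mulr_sumr sumrB sumr_const card_ord -[form y *+ n]mulr_natl /dev.
  by field.
apply: mean_le_ge0.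
- under eq_fun do rewrite prodE.
  by apply: measurable_prod => i _; exact: mFX.
- by move=> t; exact: expR_ge0.
under eq_integral do rewrite prodE.
have [_ _ ind] := iid.
rewrite (@integral_prod_independent _ _ _ T S P n Xs (fun=> F) c) //.
- rewrite lee_fin; apply: (@le_trans _ _ (\prod_(i < n) B)).
    by apply: ler_prod => i _; case: (hc i).
  rewrite prodr_const card_ord /B -expRM_natl ler_expR.
  by rewrite le_eqVlt; apply/orP; left; apply/eqP; ring.
- by move=> i; case: (hc i) => -[].
Qed.

(* The Laplace transform is used at two opposite arguments of order n^(-1/2). *)
Lemma dev_sqr_mean y b : 0 < b -> scale * form y <= b ->
  mean_le P (fun t => dev y t ^+ 2) (32 * b ^+ 2 / n%:R).
Proof.
move=> b0 fb; set s := Num.sqrt (n%:R : R).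
have nR0 : (0 : R) < n%:R by rewrite ltr0n.
have s0 : 0 < s by rewrite sqrtr_gt0.
have s1 : 1 <= s by rewrite -sqrtr1 ler_sqrt // ler1n.
have s2 : s ^+ 2 = n%:R by rewrite sqr_sqrtr // ltW.
have f0 : 0 <= scale * form y by rewrite mulr_ge0 ?scale_ge0 ?form_ge0.
(* Chosen so that the exponent 2 n (th b)^2 equals 1/2; as s >= 1, it also satisfies th b <= 1/2. *)
pose th := (2 * b * s)^-1.
have th0 : 0 < th by rewrite invr_gt0 !mulr_gt0.
have thb : th * b = (2 * s)^-1 by rewrite /th; field; rewrite !gt_eqF.
have h : `|th| * (scale * form y) <= 1 / 2.
  rewrite gtr0_norm //; apply: (@le_trans _ _ (th * b)); first by rewrite ler_pM2l.
  by rewrite thb div1r lef_pV2 ?posrE ?mulr_gt0 //; lra.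
have h' : `|- th| * (scale * form y) <= 1 / 2 by rewrite normrN.
have he : 2 * n%:R * (th * (scale * form y)) ^+ 2 <= 1 / 2.
  apply: (@le_trans _ _ (2 * n%:R * (th * b) ^+ 2)).
    have p0 : 0 <= th * (scale * form y) by rewrite mulr_ge0 // ltW.
    have pq : th * (scale * form y) <= th * b by rewrite ler_pM2l.
    rewrite ler_wpM2l ?mulr_ge0 ?(ltW nR0) //.
    by move: (th * (scale * form y)) (th * b) p0 pq => p q p0 pq; nra.
  by rewrite thb -s2 le_eqVlt; apply/orP; left; apply/eqP; field; rewrite gt_eqF.
have e2 : expR (1 / 2) <= 2 :> R.
  have : 1 + - (1 / 2) <= expR (- (1 / 2)) :> R by exact: expR_ge1Dx.
  have := expR_gt0 (1 / 2 : R); rewrite expRN; move: (expR (1 / 2)) => e e0.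
  by rewrite -(ler_pM2l e0) divff ?gt_eqF //; lra.
have h2 := mean_leD (mgf_dev h) (mgf_dev h').
have k0 : 0 <= 2 / (th * n%:R) ^+ 2 by rewrite divr_ge0 ?sqr_ge0.
apply: (mean_leW _ _ (mean_leZ k0 h2)).
  move=> t; rewrite !mulNr.
  have -> : dev y t ^+ 2 = 2 / (th * n%:R) ^+ 2 * ((th * n%:R * dev y t) ^+ 2 / 2).
    by field; rewrite nR gt_eqF.
  rewrite ler_wpM2l //; move: (th * n%:R * dev y t) => x.
  have E (a : R) : 0 <= a -> a ^+ 2 / 2 <= expR a.
    by move=> a0; apply: le_trans (expR_ge1Dxn 1 a0); rewrite lerDr.
  have := expR_gt0 x; have := expR_gt0 (- x).
  have [x0|x0] := leP 0 x; first by have := E _ x0; lra.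
  have nx0 : 0 <= - x by rewrite oppr_ge0 ltW.
  by have := E _ nx0; rewrite sqrrN; lra.
have -> : (th * n%:R) ^+ 2 = n%:R / (4 * b ^+ 2).
  by rewrite /th -s2; field; rewrite !gt_eqF.
have -> : 32 * b ^+ 2 / n%:R = 2 / (n%:R / (4 * b ^+ 2)) * (2 + 2).
  by field; rewrite nR gt_eqF.
rewrite ler_wpM2l //.
  by rewrite !divr_ge0 ?mulr_ge0 ?sqr_ge0 // ltW.
rewrite mulNr sqrrN; apply: lerD; apply: le_trans e2; by rewrite ler_expR.
Qed.

End Copies.
End Moments.
End Sample.

(** * Bounds on the covariance error *)

Lemma big_nat_ltn (V : nmodType) (F : nat -> V) N :
  \sum_(0 <= j < N | (j < N)%N) F j = \sum_(0 <= j < N) F j.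
Proof.
rewrite big_nat_cond [RHS]big_nat_cond; apply: eq_bigl => j.
by rewrite leq0n /=; case: (j < N)%N.
Qed.

Section SelfAdjoint.
Context {R : realType} {H : completeNormedModType R}.
Variable ip : {dot H for idfun}.
Hypothesis nrm : induces_norm ip.
Variable A : H -> H.
Hypothesis AA : is_adjoint ip A A.
Implicit Types x y z : H.

Lemma adjC x y : ip (A x) y = ip (A y) x.
Proof. by rewrite AA ipC. Qed.

Lemma adjDl x y z : ip (A (x + y)) z = ip (A x) z + ip (A y) z.
Proof. by rewrite !AA ipDl. Qed.

Lemma adjZl (c : R) x z : ip (A (c *: x)) z = c * ip (A x) z.
Proof. by rewrite !AA ipZl. Qed.

Lemma adj_combl (I : Type) (r : seq I) (Q : pred I) (c : I -> R) (F : I -> H) z :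
  ip (A (\sum_(i <- r | Q i) c i *: F i)) z = \sum_(i <- r | Q i) c i * ip (A (F i)) z.
Proof. by rewrite AA ip_combl; apply: eq_bigr => i _; rewrite AA. Qed.

Lemma adj_sqrD x y :
  ip (A (x + y)) (x + y) = ip (A x) x + 2 * ip (A x) y + ip (A y) y.
Proof. by rewrite adjDl !ipDr (adjC y x); ring. Qed.

Section Orthonormal.
Variables (N : nat) (u : nat -> H).
Hypothesis uN : orthonormal_on ip (fun j => j < N)%N u.

Definition comb (c : nat -> R) m : H := \sum_(m <= j < N) c j *: u j.

Lemma combS c m : (m < N)%N -> comb c m = c m *: u m + comb c m.+1.
Proof. by move=> mN; rewrite /comb big_ltn. Qed.

Lemma comb_norm c m : `|comb c m| ^+ 2 = \sum_(m <= j < N) c j ^+ 2.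
Proof.
pose D (j : nat) := (m <= j)%N && (j < N)%N.
have uD : orthonormal_on ip D u by move=> j k /andP[_ jN] /andP[_ kN]; exact: uN.
have E (V : nmodType) (F : nat -> V) :
    \sum_(m <= j < N) F j = \sum_(0 <= j < N | D j) F j.
  rewrite (big_nat_widenl _ 0) //= big_nat_cond [RHS]big_nat_cond.
  by apply: eq_bigl => j; rewrite /D; case: (j < N)%N; rewrite /= ?andbT ?andbF.
have := norm_sub_comb nrm uD N c 0.
rewrite sub0r normrN normr0 expr0n /= /comb E => ->.
rewrite [X in _ - X]big1 ?subr0 ?add0r => [|j _]; last first.
  by rewrite ipC ip0r expr0n.
by rewrite E; apply: eq_bigr => j _; rewrite ipC ip0r sub0r sqrrN.
Qed.

Lemma comb_bessel g m : \sum_(m <= j < N) ip g (u j) ^+ 2 <= `|g| ^+ 2.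
Proof.
apply: le_trans (bessel nrm uN N g).
rewrite big_nat_ltn (big_nat_widenl _ 0) //= [leRHS](bigID (fun j => m <= j)%N) /=.
by rewrite lerDl; apply: sumr_ge0 => j _; exact: sqr_ge0.
Qed.

Lemma comb_cauchy_schwarz g c m :
  `|\sum_(m <= j < N) c j * ip g (u j)| <=
  `|g| * Num.sqrt (\sum_(m <= j < N) c j ^+ 2).
Proof.
rewrite -comb_norm sqrtr_sqr normr_id -(ip_combr ip).
exact: ip_le_norm.
Qed.

(** The row starts at the diagonal: the earlier columns are accounted for, by symmetry, in earlier
    rows. This is why tr_{>= j} appears rather than the full trace. *)
Definition row_norm j : R := Num.sqrt (\sum_(j <= k < N) ip (A (u j)) (u k) ^+ 2).

Lemma row_form_le g j : (j < N)%N -> `|g| <= 1 ->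
  `|ip (A (u j)) (comb (fun k => ip g (u k)) j.+1)| <= row_norm j.
Proof.
move=> jN g1; rewrite /comb ip_combr.
under eq_bigr do rewrite mulrC.
apply: le_trans (comb_cauchy_schwarz _ _ _) _.
apply: (@le_trans _ _ (1 * Num.sqrt (\sum_(j.+1 <= k < N) ip (A (u j)) (u k) ^+ 2))).
  by rewrite ler_wpM2r ?sqrtr_ge0.
by rewrite mul1r ler_wsqrtr // [leRHS]big_ltn // lerDr sqr_ge0.
Qed.

Lemma diag_le_row j : (j < N)%N -> `|ip (A (u j)) (u j)| <= row_norm j.
Proof.
move=> jN; rewrite -sqrtr_sqr ler_wsqrtr // big_ltn // lerDl.
by apply: sumr_ge0 => k _; exact: sqr_ge0.
Qed.

Variables (d : nat) (f : nat -> H).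
Hypotheses (dN : (d <= N)%N) (fd : orthonormal_on ip (fun j => j < d)%N f).

Definition part a m : H := comb (fun j => ip (f a) (u j)) m.

(** Coordinates are removed one at a time from all f_a at once. The sum over a stays inside the
    cross term, so that row j will be paid once and not d times. *)
Lemma part_peel m : (m <= d)%N ->
  \sum_(0 <= a < d) ip (A (part a 0)) (part a 0) =
  \sum_(0 <= j < m) ((\sum_(0 <= a < d) ip (f a) (u j) ^+ 2) * ip (A (u j)) (u j) +
     2 * ip (A (u j)) (\sum_(0 <= a < d) ip (f a) (u j) *: part a j.+1)) +
  \sum_(0 <= a < d) ip (A (part a m)) (part a m).
Proof.
elim: m => [|m IH] md; first by rewrite [X in X + _]big_geq // add0r.
rewrite IH ?(ltnW md) // [in RHS]big_nat_recr //= -[RHS]addrA; congr (_ + _).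
rewrite ip_combr mulr_suml mulr_sumr -!big_split /=; apply: eq_bigr => a _.
rewrite {1 2}/part combS ?(leq_trans md) //.
by rewrite adj_sqrD adjZl ipZr adjZl -/(part a m.+1); ring.
Qed.

Lemma rows_bound :
  \sum_(0 <= a < d) ip (A (part a 0)) (part a 0) - \sum_(0 <= j < d) ip (A (u j)) (u j)
  <= 3 * \sum_(0 <= j < d) row_norm j +
     \sum_(0 <= a < d) ip (A (part a d)) (part a d).
Proof.
rewrite (part_peel (leqnn d)) addrAC lerD2r -sumrB mulr_sumr.
rewrite big_nat_cond [leRHS]big_nat_cond; apply: ler_sum => j.
rewrite andbT => /andP[_ jd].
have jN : (j < N)%N := leq_trans jd dN.
(* [g] is the projection of u_j onto the span of f, of squared norm w <= 1; the cross term of row j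
   pairs A u_j with the coordinates of g beyond j. The diagonal term (w - 1) A_jj costs one row norm
   and the doubled cross term two, hence the 3. *)
pose g := \sum_(0 <= a < d) ip (f a) (u j) *: f a.
pose w := \sum_(0 <= a < d) ip (f a) (u j) ^+ 2.
have w01 : 0 <= w <= 1.
  apply/andP; split; first by apply: sumr_ge0 => a _; exact: sqr_ge0.
  have := bessel nrm fd d (u j); rewrite nrm uN // eqxx; apply: le_trans.
  rewrite /w le_eqVlt; apply/orP; left; apply/eqP.
  rewrite big_nat_cond [RHS]big_nat_cond.
  by apply: eq_big => [a|a _]; [rewrite leq0n /=; case: (_ < d)%N|rewrite ipC].
have g1 : `|g| <= 1.
  have gw : `|g| ^+ 2 = w.
    rewrite nrm {1}/g ip_combl /w big_nat_cond [RHS]big_nat_cond.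
    apply: eq_bigr => a; rewrite andbT => /andP[_ ad].
    rewrite expr2; congr (_ * _).
    rewrite /g ip_combr big_mkord (bigD1 (Ordinal ad)) //= fd // eqxx mulr1.
    rewrite big1 ?addr0 // => b ba; rewrite fd //.
    by move: ba; rewrite -val_eqE eq_sym /= => /negPf ->; rewrite mulr0.
  rewrite -(@ler_pXn2r _ 2) ?nnegrE // expr1n gw.
  by case/andP: w01.
have -> : \sum_(0 <= a < d) ip (f a) (u j) *: part a j.+1 =
    comb (fun k => ip g (u k)) j.+1.
  rewrite /comb /part /comb.
  under eq_bigr do rewrite scaler_sumr.
  rewrite exchange_big /=; apply: eq_bigr => k _.
  rewrite /g ip_combl scaler_suml; apply: eq_bigr => a _.
  by rewrite scalerA.
have := row_form_le jN g1; have := diag_le_row jN.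
rewrite !ler_norml -/w => /andP[a1 a2] /andP[b1 b2].
case/andP: w01; move: (ip (A (u j)) (u j)) (row_norm j) a1 a2 b2 => Ajj Rj a1 a2 b2.
by nra.
Qed.

End Orthonormal.
End SelfAdjoint.

(** * Truncation of the sample to finitely many coordinates *)

Section Truncation.
Context {R : realType} {H : completeNormedModType R}.
Variable ip : {dot H for idfun}.
Hypothesis nrm : induces_norm ip.
Context {dT : measure_display} {T : measurableType dT}.
Variables (n : nat) (Xs : 'I_n -> T -> H) (t : T).

Lemma empirical_adjoint :
  is_adjoint ip (empirical_covariance ip Xs t) (empirical_covariance ip Xs t).
Proof.
move=> x y; rewrite /empirical_covariance /tensor ipZl ipZr ip_combl ip_combr.
by congr (_ * _); apply: eq_bigr => i _; rewrite mulrC (ipC ip x).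
Qed.

Lemma empirical_form x : ip (empirical_covariance ip Xs t x) x =
  n%:R^-1 * \sum_(i < n) ip (Xs i t) x ^+ 2.
Proof.
by rewrite /empirical_covariance /tensor ipZl ip_combl.
Qed.

Variables (N : nat) (u : nat -> H).
Hypothesis uN : orthonormal_on ip (fun j => j < N)%N u.

Definition residual i : R :=
  `|Xs i t| ^+ 2 - \sum_(0 <= j < N) ip (Xs i t) (u j) ^+ 2.

Lemma comb_residual x : `|x - comb N u (fun j => ip x (u j)) 0| ^+ 2 =
  `|x| ^+ 2 - \sum_(0 <= j < N) ip x (u j) ^+ 2.
Proof.
rewrite /comb -!(big_nat_ltn _ N) (norm_sub_comb nrm uN) [X in _ + X]big1 ?addr0 // => j _.
by rewrite subrr expr0n.
Qed.

(** With z the truncation of x = X_i, <x, f>^2 - <z, f>^2 = <x - z, f> <x + z, f> <= 2 |x - z| |x|.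
    The weight e in the AM-GM inequality leaves a small multiple of |x|^2 and a large one of the
    residual, which N makes small. *)
Lemma truncated_form_le (e : R) f : 0 < e -> `|f| = 1 ->
  ip (empirical_covariance ip Xs t f) f <=
  ip (empirical_covariance ip Xs t (comb N u (fun j => ip f (u j)) 0))
     (comb N u (fun j => ip f (u j)) 0) +
  n%:R^-1 * \sum_(i < n) (e * `|Xs i t| ^+ 2 + e^-1 * residual i).
Proof.
move=> e0 f1; rewrite !empirical_form -mulrDr ler_wpM2l ?invr_ge0 //.
rewrite -big_split /=; apply: ler_sum => i _.
set x := Xs i t; set z := comb N u (fun j => ip x (u j)) 0.
have -> : ip x (comb N u (fun j => ip f (u j)) 0) = ip z f.
  rewrite /z /comb ip_combr ip_combl; apply: eq_bigr => j _.
  by rewrite (ipC ip f) mulrC.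
have rE : residual i = `|x - z| ^+ 2 by rewrite comb_residual.
rewrite rE.
have z_le : `|z| <= `|x|.
  rewrite -(@ler_pXn2r _ 2) ?nnegrE // (comb_norm nrm uN).
  exact: comb_bessel.
have xf : `|ip x f| <= `|x| by have := ip_le_norm nrm x f; rewrite f1 mulr1.
have zf : `|ip z f| <= `|x|.
  by have := ip_le_norm nrm z f; rewrite f1 mulr1 => /le_trans; exact.
have df : `|ip (x - z) f| <= `|x - z|.
  by have := ip_le_norm nrm (x - z) f; rewrite f1 mulr1.
have E : ip x f ^+ 2 - ip z f ^+ 2 = ip (x - z) f * (ip x f + ip z f).
  by rewrite ipBl; ring.
have h : ip x f ^+ 2 - ip z f ^+ 2 <= `|x - z| * (2 * `|x|).
  rewrite E; apply: le_trans (ler_norm _) _; rewrite normrM.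
  apply: ler_pM => //; apply: le_trans (ler_normD _ _) _; lra.
rewrite -lerBlDl; apply: le_trans h _.
move: (`|x - z|) (`|x|) => r X.
have -> : e * X ^+ 2 + e^-1 * r ^+ 2 = r * (2 * X) + e^-1 * (r - e * X) ^+ 2.
  by field; rewrite gt_eqF.
by rewrite lerDl mulr_ge0 ?sqr_ge0 // invr_ge0 ltW.
Qed.

End Truncation.

(** * Second moments of the entries of the covariance error *)

Section Deviation.
Context {R : realType} {H : completeNormedModType R}.
Variable ip : {dot H for idfun}.
Hypothesis nrm : induces_norm ip.
Context {dT : measure_display} {T : measurableType dT} (P : probability T R).
Variables (X : T -> H) (Sigma : H -> H) (C1 : R).
Hypotheses (mX : random_vector X) (cov : is_covariance ip P X Sigma).
Hypothesis sg : sub_gaussian ip P X C1.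
Variables (n : nat) (Xs : 'I_n -> T -> H).
Hypotheses (n0 : (1 <= n)%N) (iid : iid_copies P X Xs).
Variables (p : option nat) (lam : nat -> R) (u : nat -> H).
Hypothesis eb : eigenbasis ip p Sigma lam u.
Hypothesis lam_gt0 : forall j, below p j -> 0 < lam j.

Definition error t : H -> H := fun x => empirical_covariance ip Xs t x - Sigma x.

Let SS : is_adjoint ip Sigma Sigma := covariance_adjoint cov.

Lemma error_adjoint t : is_adjoint ip (error t) (error t).
Proof.
by move=> x y; rewrite /error ipBl ipBr SS (empirical_adjoint ip Xs t).
Qed.

Lemma error_form t x : ip (error t x) x = dev ip Sigma Xs x t.
Proof. by rewrite /error ipBl empirical_form. Qed.

(** The added 1 keeps the constant positive when [scale C1] vanishes. *)
Definition kappa : R := scale C1 + 1.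

Lemma kappa_gt0 : 0 < kappa.
Proof. by have := scale_ge0 C1; rewrite /kappa; lra. Qed.

Let nR0 : (0 : R) < n%:R. Proof. by rewrite ltr0n. Qed.

Lemma error_polar t (a b : R) x y :
  4 * (a * b) * ip (error t x) y =
  dev ip Sigma Xs (a *: x + b *: y) t - dev ip Sigma Xs (a *: x + - b *: y) t.
Proof.
have AA := error_adjoint t.
by rewrite -!error_form !(adj_sqrD AA) !(adjZl AA) !ipZr; ring.
Qed.

(** Polarisation reduces an entry to two diagonal deviations; a and b normalise x and y so that the
    two polarised vectors have variance of order 1. *)
Lemma error_sqr_mean (a b : R) x y : 0 < a -> 0 < b ->
  form ip Sigma (a *: x + b *: y) <= 4 -> form ip Sigma (a *: x + - b *: y) <= 4 ->
  mean_le P (fun t => ip (error t x) y ^+ 2)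
    (128 * kappa ^+ 2 / n%:R / (a ^+ 2 * b ^+ 2)).
Proof.
move=> a0 b0 f1 f2.
have k0 := kappa_gt0; have k4 : 0 < 4 * kappa by lra.
have sf z : form ip Sigma z <= 4 -> scale C1 * form ip Sigma z <= 4 * kappa.
  move=> fz; have := scale_ge0 C1; have := form_ge0 cov z; rewrite /kappa.
  by move: (scale C1) (form ip Sigma z) fz => A B; nra.
have h1 := dev_sqr_mean nrm mX cov sg n0 iid k4 (sf _ f1).
have h2 := dev_sqr_mean nrm mX cov sg n0 iid k4 (sf _ f2).
have ab0 : 0 < a ^+ 2 * b ^+ 2 by rewrite mulr_gt0 // exprn_gt0.
have c0 : 0 <= (8 * (a ^+ 2 * b ^+ 2))^-1 by rewrite invr_ge0; lra.
apply: (mean_leW _ _ (mean_leZ c0 (mean_leD h1 h2))).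
  move=> t; have := error_polar t a b x y; set e := ip (error t x) y.
  move: (dev _ _ _ _ t) (dev _ _ _ _ t) => d1 d2 E.
  rewrite ler_pdivlMl; last by lra.
  have -> : 8 * (a ^+ 2 * b ^+ 2) * e ^+ 2 = (4 * (a * b) * e) ^+ 2 / 2 by field.
  by rewrite E; have := sqr_ge0 (d1 + d2); lra.
rewrite le_eqVlt; apply/orP; left; apply/eqP; field.
by rewrite !gt_eqF.
Qed.

Lemma cov_entry j k : below p j -> below p k ->
  ip (Sigma (u j)) (u k) = lam j * (j == k)%:R.
Proof.
by move=> pj pk; have [[ou _] -> //] := eb; rewrite ipZl ou.
Qed.

Lemma error_entry_mean j k : below p j -> below p k ->
  mean_le P (fun t => ip (error t (u j)) (u k) ^+ 2)
    (128 * kappa ^+ 2 / n%:R * (lam j * lam k)).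
Proof.
move=> pj pk; have lj := lam_gt0 pj; have lk := lam_gt0 pk.
(* The rescaled eigenvectors have variance 1, so the polarised ones have variance 2, or 4 and 0 when
   j = k. *)
pose a := (Num.sqrt (lam j))^-1; pose b := (Num.sqrt (lam k))^-1.
have a0 : 0 < a by rewrite invr_gt0 sqrtr_gt0.
have b0 : 0 < b by rewrite invr_gt0 sqrtr_gt0.
have a2 : a ^+ 2 = (lam j)^-1 by rewrite exprVn sqr_sqrtr // ltW.
have b2 : b ^+ 2 = (lam k)^-1 by rewrite exprVn sqr_sqrtr // ltW.
have al : a * (a * lam j) = 1 by rewrite mulrA -expr2 a2 mulVf // gt_eqF.
have fE (c : R) : c ^+ 2 = b ^+ 2 -> form ip Sigma (a *: u j + c *: u k) =
    2 + 2 * (a * (c * (lam j * (j == k)%:R))).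
  move=> c2; have cl : c * (c * lam k) = 1 by rewrite mulrA -expr2 c2 b2 mulVf // gt_eqF.
  rewrite /form (adj_sqrD SS) !(adjZl SS) !ipZr !cov_entry // !eqxx !mulr1 al cl.
  by ring.
have ab : j = k -> a * (b * lam j) = 1.
  by move=> jk; rewrite /b -jk -/a al.
have -> : lam j * lam k = (a ^+ 2 * b ^+ 2)^-1 by rewrite a2 b2 -invfM invrK.
apply: error_sqr_mean => //; rewrite fE ?sqrrN //.
  by case: eqVneq => [/ab e|_]; rewrite /= ?mulr1 ?mulr0; lra.
by case: eqVneq => [/ab e|_]; rewrite /= ?mulr1 ?mulr0; lra.
Qed.

Section Truncated.
Variable N : nat.
Hypothesis pN : forall j, (j < N)%N -> below p j.

Let uN : orthonormal_on ip (fun j => j < N)%N u.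
Proof. by have [[ou _] _ _] := eb; move=> j k jN kN; apply: ou; exact: pN. Qed.

Lemma row_norm_mean j (tr : R) : (j < N)%N -> \sum_(j <= k < N) lam k <= tr ->
  mean_le P (fun t => row_norm ip (error t) N u j)
    (12 * kappa * Num.sqrt (lam j * tr / n%:R)).
Proof.
move=> jN htr; have lj := lam_gt0 (pN jN).
have k0 := kappa_gt0.
have lt : lam j <= tr.
  apply: le_trans htr; rewrite big_ltn // lerDl big_nat_cond.
  by apply: sumr_ge0 => k /andP[/andP[_ kN] _]; exact/ltW/lam_gt0/pN.
have tr0 : 0 < tr := lt_le_trans lj lt.
have s0 : 0 < lam j * tr / n%:R by rewrite divr_gt0 // mulr_gt0.
apply: mean_le_sqrt.
- by rewrite !mulr_gt0 // sqrtr_gt0.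
- by move=> t; apply: sumr_ge0 => k _; exact: sqr_ge0.
apply: (@mean_leW _ _ _ _ _
  (fun t => \sum_(j <= k < N | (k < N)%N) ip (error t (u j)) (u k) ^+ 2)
  (\sum_(j <= k < N | (k < N)%N) 128 * kappa ^+ 2 / n%:R * (lam j * lam k))).
- move=> t; rewrite big_nat_cond [leRHS]big_nat_cond.
  by rewrite (eq_bigl (fun k => (j <= k < N)%N && (k < N)%N)) // => k; case: (k < N)%N;
    rewrite ?andbT ?andbF.
- rewrite -mulr_sumr -mulr_sumr exprMn sqr_sqrtr ?(ltW s0) //.
  have -> : (12 * kappa) ^+ 2 * (lam j * tr / n%:R) =
      144 * kappa ^+ 2 / n%:R * (lam j * tr) by ring.
  apply: ler_pM.
  + by rewrite divr_ge0 ?(ltW nR0) // mulr_ge0 ?sqr_ge0.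
  + rewrite mulr_ge0 ?(ltW lj) //.
    by apply: sumr_ge0 => k kN; exact/ltW/lam_gt0/pN.
  + rewrite ler_pM2r ?invr_gt0 // ler_wpM2r ?sqr_ge0 //; lra.
  rewrite ler_wpM2l ?(ltW lj) //; apply: le_trans htr.
  rewrite big_nat_cond [leRHS]big_nat_cond.
  by rewrite (eq_bigl (fun k => (j <= k < N)%N && true)) // => k; case: (k < N)%N;
    rewrite ?andbT ?andbF.
- by apply: mean_le_sum => k kN; apply: error_entry_mean; exact: pN.
Qed.

(** * The quadratic form on the tail block *)

Section Block.
Variable d : nat.
Hypothesis dN : (d < N)%N.

Definition block (x : 'I_(N - d) -> R) : H := \sum_(i < N - d) x i *: u (d + i)%N.

Let block_lt (i : 'I_(N - d)) : (d + i < N)%N.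
Proof. by rewrite -ltn_subRL. Qed.

Lemma sum_block (V : nmodType) (F : nat -> V) :
  \sum_(d <= k < N) F k = \sum_(i < N - d) F (d + i)%N.
Proof.
by rewrite -{1}[d]add0n big_addn big_mkord; apply: eq_bigr => i _; rewrite addnC.
Qed.

Lemma block_comb (c : nat -> R) : comb N u c d = block (fun i => c (d + i)%N).
Proof.
by rewrite /comb /block sum_block.
Qed.

Lemma block_form x : form ip Sigma (block x) = \sum_(i < N - d) lam (d + i)%N * x i ^+ 2.
Proof.
rewrite /form /block (adj_combl SS); apply: eq_bigr => i _.
rewrite ip_combr (bigD1 i) //= cov_entry ?pN // eqxx mulr1.
rewrite big1 ?addr0 => [|k ki]; first by ring.
rewrite cov_entry ?pN // eqn_add2l.
by move: ki; rewrite -val_eqE eq_sym /= => /negPf ->; rewrite !mulr0.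
Qed.

Lemma block_parallelogram A : is_adjoint ip A A ->
  parallelogram (fun x => ip (A (block x)) (block x)).
Proof.
move=> AA x y.
have -> : block (fun i => x i + y i) = block x + block y.
  by rewrite /block -big_split; apply: eq_bigr => i _; rewrite scalerDl.
have -> : block (fun i => x i - y i) = block x + (- 1) *: block y.
  rewrite /block scaler_sumr -big_split; apply: eq_bigr => i _.
  by rewrite scalerBl scalerA mulN1r scaleNr.
by rewrite !(adj_sqrD AA) !(adjZl AA) !ipZr; ring.
Qed.

Lemma block_expand A x : is_adjoint ip A A ->
  ip (A (block x)) (block x) =
  \sum_(i < N - d) \sum_(j < N - d) x i * x j * ip (A (u (d + i)%N)) (u (d + j)%N).
Proof.
move=> AA; rewrite /block (adj_combl AA); apply: eq_bigr => i _.
by rewrite ip_combr mulr_sumr; apply: eq_bigr => j _; rewrite mulrA.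
Qed.

(** A crude Lipschitz bound, growing with the size of the block; it is affordable because the mesh h
    is chosen after N. *)
Lemma block_round A x v (h : R) : is_adjoint ip A A ->
  (forall i, `|x i| <= 1) -> (forall i, `|v i| <= 1) -> (forall i, `|v i - x i| <= h) ->
  ip (A (block v)) (block v) <= ip (A (block x)) (block x) +
    2 * h * \sum_(i < N - d) \sum_(j < N - d) `|ip (A (u (d + i)%N)) (u (d + j)%N)|.
Proof.
move=> AA x1 v1 vx; rewrite !block_expand // -lerBlDl -sumrB mulr_sumr.
apply: ler_sum => i _; rewrite -sumrB mulr_sumr; apply: ler_sum => j _.
rewrite -mulrBl; apply: le_trans (ler_norm _) _; rewrite normrM ler_wpM2r //.
have -> : v i * v j - x i * x j = (v i - x i) * v j + x i * (v j - x j) by ring.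
apply: le_trans (ler_normD _ _) _; rewrite !normrM.
have -> : 2 * h = h * 1 + 1 * h by ring.
by apply: lerD; exact: ler_pM.
Qed.

Definition rate (l tr : R) : R := Num.max (Num.sqrt (l * tr / n%:R)) (tr / n%:R).

(** The two regimes of the minimum produce the two terms of the maximum: 1 gives tr / n, and the
    square root gives sqrt(l tr / n). *)
Lemma rate_inv (l tr : R) : 0 < l -> 0 < tr ->
  tr / n%:R / Num.min 1 (Num.sqrt (tr / l / n%:R)) <= rate l tr.
Proof.
move=> l0 tr0.
have r0 : 0 < tr / l / n%:R by rewrite !divr_gt0.
have s0 : 0 < Num.sqrt (tr / l / n%:R) by rewrite sqrtr_gt0.
rewrite /rate le_max; case: (leP 1 (Num.sqrt (tr / l / n%:R))) => _.
  by rewrite divr1 lexx orbT.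
have lt0 : 0 <= l * tr / n%:R by apply/ltW; rewrite divr_gt0 // mulr_gt0.
apply/orP; left; rewrite ler_pdivrMr // -sqrtrM //.
have -> : l * tr / n%:R * (tr / l / n%:R) = (tr / n%:R) ^+ 2.
  by field; rewrite !gt_eqF.
by rewrite sqrtr_sqr ler_norm.
Qed.

Lemma block_sup_mean (tr : R) : lam d <= tr -> \sum_(d <= k < N) lam k <= tr ->
  exists2 G : T -> R,
    mean_le P G (768 * kappa * rate (lam d) tr + tr / n%:R) &
    forall t (c : nat -> R), \sum_(d <= j < N) c j ^+ 2 <= 1 ->
      ip (error t (comb N u c d)) (comb N u c d) <= G t.
Proof.
move=> ltr str.
have k0 := kappa_gt0.
have ld : 0 < lam d by apply/lam_gt0/pN.
have tr0 : 0 < tr := lt_le_trans ld ltr.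
pose r := tr / lam d.
have r1 : 1 <= r by rewrite ler_pdivlMr // mul1r.
(* [mu] / 2 is the Laplace argument in units of 1 / b'. The cap 1 keeps it in the admissible range,
   and the other bound keeps n mu^2 below r, the order of the relative entropy. *)
pose mu := Num.min 1 (Num.sqrt (r / n%:R)).
have rn0 : 0 < r / n%:R by rewrite divr_gt0 //; lra.
have mu0 : 0 < mu by rewrite lt_min ltr01 sqrtr_gt0.
have mu1 : mu <= 1 by rewrite ge_min lexx.
have mu2 : n%:R * mu ^+ 2 <= r.
  rewrite -ler_pdivlMl // mulrC -(sqr_sqrtr (ltW rn0)).
  by rewrite ler_pXn2r ?nnegrE ?sqrtr_ge0 ?(ltW mu0) // ge_min lexx orbT.
pose b' := 128 * kappa * lam d.
have b'0 : 0 < b' by rewrite !mulr_gt0.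
pose th := mu / (2 * b').
have th0 : 0 < th by rewrite divr_gt0 // mulr_gt0.
have thb : th * b' = mu / 2 by rewrite /th; field; rewrite gt_eqF.
(* This is the exponent 2 n (mu / 2)^2 of [mgf_dev], so that exp (q - s) has mean at most 1 at every
   good point. *)
pose s := n%:R * mu ^+ 2 / 2.
have thn : 0 < th * n%:R by rewrite mulr_gt0.
(* [V] bounds the mean of the sum of the absolute entries, by |z| <= 1 + z^2; h is then taken small
   enough for rounding to cost at most tr / n. *)
pose V : R := \sum_(i < N - d) \sum_(j < N - d)
  (1 + 128 * kappa ^+ 2 / n%:R * (lam (d + i)%N * lam (d + j)%N)).
have V0 : 0 <= V.
  apply: sumr_ge0 => i _; apply: sumr_ge0 => j _; rewrite addr_ge0 // mulr_ge0 //.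
    by rewrite divr_ge0 ?(ltW nR0) // mulr_ge0 ?sqr_ge0.
  by rewrite mulr_ge0 //; apply/ltW/lam_gt0/pN.
pose h := tr / n%:R / (2 * (V + 1)).
have h0 : 0 < h by rewrite !divr_gt0 // mulr_gt0 //; lra.
have hV : 2 * h * V <= tr / n%:R.
  have tn0 : 0 < tr / n%:R by rewrite divr_gt0.
  have -> : 2 * h * V = tr / n%:R * (V / (V + 1)).
    by rewrite /h; field; rewrite !gt_eqF //; lra.
  by rewrite ler_piMr ?(ltW tn0) // ler_pdivrMr; lra.
have l01 (i : 'I_(N - d)) : 0 <= lam (d + i)%N / lam d <= 1.
  have li : 0 < lam (d + i)%N by apply/lam_gt0/pN.
  apply/andP; split; first by rewrite divr_ge0 ?(ltW li) ?(ltW ld).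
  by rewrite ler_pdivrMr // mul1r; have [_ _] := eb; apply; [exact: leq_addr|exact: pN].
have be0 : 0 < lam d / tr by rewrite divr_gt0.
have sl : lam d / tr * (\sum_(i < N - d) lam (d + i)%N / lam d) <= 1.
  rewrite -mulr_suml; set S := \sum_(i < N - d) _.
  have -> : lam d / tr * (S / lam d) = S / tr by field; rewrite !gt_eqF.
  by rewrite ler_pdivrMr // mul1r /S -sum_block.
(* With the weights lam_{d+i} / lam_d, good points have variance at most 128 lam_d, which is the
   origin of b'. *)
have [J [pt [wt [nt [good [wt0 wt2 gform net]]]]]] := gaussian_net l01 be0 sl h0.
pose q t x := th * n%:R * dev ip Sigma Xs (block x) t.
have mgf y : good y -> mean_le P (fun t => expR (q t (pt y) - s)) 1.
  move=> gy; have f128 : form ip Sigma (block (pt y)) <= 128 * lam d.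
    rewrite block_form -ler_pdivrMr // mulr_suml.
    by under eq_bigr do rewrite mulrAC; exact: gform.
  have f0 := form_ge0 cov (block (pt y)); have sc0 := scale_ge0 C1.
  have sfb : scale C1 * form ip Sigma (block (pt y)) <= b'.
    rewrite /b' /kappa; move: (form _ _ _) f128 f0 => F; move: (scale C1) sc0 => S.
    by move: (lam d) ld => L; nra.
  have sf0 : 0 <= scale C1 * form ip Sigma (block (pt y)) by rewrite mulr_ge0.
  have ths : th * (scale C1 * form ip Sigma (block (pt y))) <= mu / 2.
    by rewrite -thb ler_pM2l.
  have half : `|th| * (scale C1 * form ip Sigma (block (pt y))) <= 1 / 2.
    by rewrite gtr0_norm //; lra.
  have := mean_leZ (expR_ge0 (- s)) (mgf_dev nrm mX cov sg n0 iid half).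
  apply: mean_leW => [t|]; first by rewrite -expRD /q addrC.
  rewrite -expRD -[leRHS]expR0 ler_expR.
  move: ths (mulr_ge0 (ltW th0) sf0); rewrite /s; move: (th * (_ * _)) => z z1 z0.
  have zz : z ^+ 2 <= (mu / 2) ^+ 2 by rewrite ler_pXn2r ?nnegrE //; lra.
  have : n%:R * z ^+ 2 <= n%:R * (mu / 2) ^+ 2 by rewrite ler_pM2l.
  have -> : n%:R * (mu / 2) ^+ 2 = n%:R * mu ^+ 2 / 4 by field.
  lra.
exists (fun t => (th * n%:R)^-1 * (((2 * (lam d / tr))^-1 + s) +
    (\sum_(y | good y) wt y * expR (q t (pt y) - s)) + \sum_y nt y * q t (pt y)) +
  2 * h * (\sum_(i < N - d) \sum_(j < N - d) `|ip (error t (u (d + i)%N)) (u (d + j)%N)|)).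
  have m1 : mean_le P (fun t => \sum_(y | good y) wt y * expR (q t (pt y) - s)) 2.
    apply: (mean_leW (fun=> lexx _) wt2).
    rewrite -[X in mean_le _ _ X](eq_bigr _ (fun y _ => mulr1 (wt y))).
    by apply: mean_le_sum => y gy; apply: mean_leZ => //; exact: mgf.
  have m2 : mean_le P (fun t => \sum_y nt y * q t (pt y)) 0.
    apply: mean_le_of.
    have E : \sum_y nt y * (th * n%:R * 0) = 0 by rewrite big1 // => y _; rewrite !mulr0.
    rewrite -[X in has_mean _ _ X]E.
    apply: has_mean_sum => y _; do 2 apply: has_meanZ.
    exact: (has_mean_dev nrm mX cov n0 iid).
  have m3 : mean_le P (fun t => \sum_(i < N - d) \sum_(j < N - d)
      `|ip (error t (u (d + i)%N)) (u (d + j)%N)|) V.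
    apply: mean_le_sum => i _; apply: mean_le_sum => j _.
    apply: (@mean_leW _ _ _ _ _
      (fun t => 1 + ip (error t (u (d + i)%N)) (u (d + j)%N) ^+ 2) _ _ _ (lexx _)).
      move=> t; rewrite -[X in _ <= _ + X]real_normK ?num_real //.
      by move: (`|_|) (normr_ge0 (ip (error t (u (d + i)%N)) (u (d + j)%N))) => z z0; nra.
    by apply: mean_leD; [exact: mean_le_cst|apply: error_entry_mean; exact: pN].
  have thn_i : 0 <= (th * n%:R)^-1 by rewrite invr_ge0 ltW.
  have h20 : 0 <= 2 * h by rewrite mulr_ge0 // ltW.
  have M := mean_leD (mean_leZ thn_i (mean_leD (mean_leD
    (mean_le_cst P ((2 * (lam d / tr))^-1 + s)) m1) m2)) (mean_leZ h20 m3).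
  apply: (mean_leW _ _ M) => //; apply: lerD => //.
  have -> : (2 * (lam d / tr))^-1 = r / 2 by rewrite /r; field; rewrite !gt_eqF.
  (* Relative entropy r / 2, level s <= r / 2, and weighted exponentials of mean at most 2 <= 2 r.
     The constant 768 is 3 times 2 times 128. *)
  apply: (@le_trans _ _ ((th * n%:R)^-1 * (3 * r))).
    by rewrite ler_wpM2l // /s; lra.
  have -> : (th * n%:R)^-1 * (3 * r) = 768 * kappa * (tr / n%:R / mu).
    by rewrite /th /b' /r; field; rewrite !gt_eqF.
  apply: ler_wpM2l; first by apply: mulr_ge0; [exact: ler0n|exact: ltW].
  exact: (rate_inv ld tr0).
move=> t c c1.
have AA := error_adjoint t.
have c2 : \sum_(i < N - d) c (d + i)%N ^+ 2 <= 1.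
  by rewrite -(sum_block (fun k => c k ^+ 2)).
have [x [xc cx sup]] := net _ c2.
have ci (i : 'I_(N - d)) : `|c (d + i)%N| <= 1.
  rewrite -(@ler_pXn2r _ 2) ?nnegrE // real_normK ?num_real // expr1n.
  apply: le_trans c2; rewrite (bigD1 i) //= lerDl.
  by apply: sumr_ge0 => j _; exact: sqr_ge0.
rewrite block_comb.
apply: le_trans (block_round AA _ ci cx) _.
  by move=> i; exact: le_trans (xc i) (ci i).
rewrite lerD2r -ler_pdivrMl ?invr_gt0 // invrK error_form -/(q t x).
apply: sup => y z.
have := block_parallelogram AA y z; rewrite !error_form /q => E.
by rewrite -mulrDr E; ring.
Qed.

End Block.
End Truncated.
End Deviation.

(** Treats finite and infinite dimension together: M is lowered to the dimension if it exceeds it,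
    which removes no actual index. *)
Lemma below_cut p d M : below p d -> (d < M)%N ->
  exists N, [/\ (d < N)%N, (N <= M)%N, forall j, (j < N)%N -> below p j &
    forall j, (N <= j < M)%N -> ~~ below p j].
Proof.
case: p => [m|] /= dm dM; last first.
  exists M; split => // j /andP[Mj jM].
  by have := leq_trans jM Mj; rewrite ltnn.
exists (minn m M); split.
- by rewrite leq_min dm dM.
- exact: geq_minr.
- by move=> j; rewrite leq_min => /andP[].
- by move=> j /andP[]; rewrite geq_min -leqNgt => /orP[//|Mj jM];
    have := leq_trans jM Mj; rewrite ltnn.
Qed.

(** * Tail sums of eigenvalues *)

Section TailTrace.
Context {R : realType} (p : option nat) (lam : nat -> R) (M : R).
Hypothesis lam_ge0 : forall j, below p j -> 0 <= lam j.
Hypothesis lamM : forall N, \sum_(0 <= j < N | below p j) lam j <= M.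

Let tail_sum_le r N : \sum_(r <= j < N | below p j) lam j <= M.
Proof.
have [rN|Nr] := leqP r N.
  apply: le_trans (lamM N); rewrite [leRHS](big_cat_nat _ rN) //= lerDr.
  exact: sumr_ge0.
rewrite big_geq ?(ltnW Nr) //; apply: le_trans (lamM 0).
by rewrite big_geq.
Qed.

Let tail_nondec r :
  nondecreasing_seq (fun N => \sum_(r <= j < N | below p j) lam j).
Proof.
move=> m n mn; have [rm|mr] := leqP r m; last first.
  by rewrite [leLHS]big_geq ?(ltnW mr) //; exact: sumr_ge0.
by rewrite [leRHS](big_cat_nat rm mn) //= lerDl; exact: sumr_ge0.
Qed.

Let tail_cvg r : cvgn (fun N => \sum_(r <= j < N | below p j) lam j).
Proof.
by apply: nondecreasing_is_cvgn => //; exists M => _ [N _ <-].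
Qed.

Lemma tail_trace_ge r N : \sum_(r <= j < N | below p j) lam j <= tail_trace p lam r.
Proof.
exact: (nondecreasing_cvgn_le (@tail_nondec r) (@tail_cvg r) N).
Qed.

Lemma tail_trace_le r s : (r <= s)%N -> tail_trace p lam s <= tail_trace p lam r.
Proof.
move=> rs; apply: limr_le; first exact: tail_cvg.
near=> N; apply: le_trans (tail_trace_ge r N).
have sN : (s <= N)%N by near: N; exact: nbhs_infty_ge.
by rewrite [leRHS](big_cat_nat rs sN) //= lerDr; exact: sumr_ge0.
Unshelve. all: by end_near. Qed.

End TailTrace.

(** * Expected excess risk *)

Section ExcessRiskBound.
Context {R : realType} {H : completeNormedModType R}.
Variable ip : {dot H for idfun}.
Hypothesis nrm : induces_norm ip.
Context {dT : measure_display} {T : measurableType dT} (P : probability T R).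
Variables (X : T -> H) (Sigma : H -> H) (C1 : R).
Hypotheses (mX : random_vector X) (sqX : square_integrable P X).
Hypotheses (cov : is_covariance ip P X Sigma) (sg : sub_gaussian ip P X C1).
Variables (n : nat) (Xs : 'I_n -> T -> H).
Hypotheses (n0 : (1 <= n)%N) (iid : iid_copies P X Xs).
Variables (p : option nat) (lam : nat -> R) (u : nat -> H).
Hypothesis eb : eigenbasis ip p Sigma lam u.
Hypothesis lam_gt0 : forall j, below p j -> 0 < lam j.

Definition second_moment : R := fine (\int[P]_t (`|X t| ^+ 2)%:E)%E.

Let second_momentE : (\int[P]_t (`|X t| ^+ 2)%:E = second_moment%:E)%E.
Proof.
rewrite fineK // ge0_fin_numE; first by move: sqX; rewrite /square_integrable unlock.
by apply: integral_ge0 => t _; rewrite lee_fin sqr_ge0.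
Qed.

Let SS : is_adjoint ip Sigma Sigma := covariance_adjoint cov.
Let i0 : 'I_n := Ordinal n0.

Lemma form_eigen j : below p j -> form ip Sigma (u j) = lam j.
Proof. by move=> pj; rewrite /form (cov_entry eb) // eqxx mulr1. Qed.

Let has_mean_partial N : has_mean P
  (fun t => \sum_(0 <= j < N | below p j) ip (Xs i0 t) (u j) ^+ 2)
  (\sum_(0 <= j < N | below p j) lam j).
Proof.
apply: has_mean_sum => j pj; rewrite -form_eigen //.
exact: (has_mean_copy_ip nrm mX cov iid).
Qed.

Let has_mean_power i : has_mean P (fun t => `|Xs i t| ^+ 2) second_moment.
Proof. exact: (has_mean_copy_norm mX iid). Qed.

Lemma sum_eigen_le N : \sum_(0 <= j < N | below p j) lam j <= second_moment.
Proof.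
have [fi fe] := has_mean_partial N; have [gi ge] := has_mean_power i0.
rewrite -lee_fin -fe -ge; apply: le_integral => // t _; rewrite lee_fin.
have [be _ _] := eb; exact: (bessel nrm (basis_orthonormal be)).
Qed.

(** The trace of Sigma is the mean of |X|^2: Parseval for one copy, integrated by monotone
    convergence. This lets a finite N capture almost all of the second moment. *)
Lemma sum_eigen_cvg :
  (fun N => \sum_(0 <= j < N | below p j) lam j) @ \oo --> second_moment.
Proof.
have [be _ _] := eb.
pose S N t : R := \sum_(0 <= j < N | below p j) ip (Xs i0 t) (u j) ^+ 2.
have SE t : (fun N => (S N t)%:E) @ \oo --> (`|Xs i0 t| ^+ 2)%:E.
  by apply: cvg_EFin; [near=> N|exact: (parseval nrm be)].
have cv : (fun N => \int[P]_t (S N t)%:E)%E @ \oo --> (\int[P]_t (`|Xs i0 t| ^+ 2)%:E)%E.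
  have -> : (\int[P]_t (`|Xs i0 t| ^+ 2)%:E = \int[P]_t limn (fun N => (S N t)%:E))%E.
    by apply: eq_integral => t _; apply/esym/cvg_lim => //; exact: SE.
  apply: cvg_monotone_convergence => //.
  - by move=> N; have [/integrableP[] //] := has_mean_partial N.
  - by move=> N t _; rewrite lee_fin; apply: sumr_ge0 => j _; exact: sqr_ge0.
  - move=> t _ k l kl; rewrite lee_fin /S; apply: sum_below_ler => // j _.
    exact: sqr_ge0.
have [_ e2] := has_mean_power i0.
move: cv; rewrite e2 => /fine_cvg; apply: cvg_trans.
rewrite (_ : (fun N => _) = fine \o (fun N => \int[P]_t (S N t)%:E)%E) //.
by apply/funext => N /=; have [_ ->] := has_mean_partial N.
Unshelve. all: by end_near. Qed.

Lemma sum_eigen_close d (e : R) : below p d -> 0 < e ->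
  exists N, [/\ (d < N)%N, forall j, (j < N)%N -> below p j &
    second_moment - \sum_(0 <= j < N) lam j <= e].
Proof.
move=> pd e0; have /cvgrPdist_le/(_ _ e0) [N0 _ hN] := sum_eigen_cvg.
pose N1 := maxn N0 d.+1.
have hN1 : second_moment - \sum_(0 <= j < N1 | below p j) lam j <= e.
  by apply: le_trans (ler_norm _) _; apply: hN; rewrite /= leq_maxl.
have [N [dN NN1 pN pN1]] := below_cut pd (leq_maxr N0 d.+1).
have tail0 : \sum_(N <= j < maxn N0 d.+1 | below p j) lam j = 0.
  by rewrite big_nat_cond big1 // => j /andP[jN pj]; move: (pN1 j jN); rewrite pj.
exists N; split => //; move: hN1; rewrite (big_cat_nat _ NN1) //= tail0 addr0.
rewrite big_nat_cond [in X in _ -> X]big_nat_cond.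
rewrite (eq_bigl (fun j => (0 <= j < N)%N && true)) // => j.
by rewrite leq0n /= andbT andb_idr //; exact: pN.
Qed.

Variables (d : nat) (lamhat : T -> nat -> R) (uhat : T -> nat -> H).
Hypotheses (ebhat : forall t, eigenbasis ip p (empirical_covariance ip Xs t)
                                 (lamhat t) (uhat t)).
Hypothesis lamhat_ge0 : forall t j, below p j -> 0 <= lamhat t j.
Hypothesis pd : below p d.

Let pj j : (j <= d)%N -> below p j. Proof. exact: (below_le pd). Qed.

Let onhat t : orthonormal_on ip (fun j => j < d)%N (uhat t).
Proof.
have [[ou _] _ _] := ebhat t => j k jd kd; apply: ou; exact/pj/ltnW.
Qed.

Let lam_ge0 j : below p j -> 0 <= lam j. Proof. by move=> h; exact/ltW/lam_gt0. Qed.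

(** The chain is: cut the risk at N, add the empirical optimality from [ky_fan], and truncate the
    estimated eigenvectors to N coordinates so that both sides concern the same finite vectors. Only
    then do the forms of Sigma and of its estimator combine into forms of the error. *)
Lemma excess_risk_decomposition t N (e : R) :
  (d < N)%N -> (forall j, (j < N)%N -> below p j) -> 0 < e ->
  excess_risk ip p Sigma u d (uhat t) <=
  3 * \sum_(0 <= j < d) row_norm ip (error ip Sigma Xs t) N u j +
  \sum_(0 <= a < d) ip (error ip Sigma Xs t (part ip N u (uhat t) a d))
                       (part ip N u (uhat t) a d) +
  \sum_(0 <= a < d) n%:R^-1 * \sum_(i < n)
     (e * `|Xs i t| ^+ 2 + e^-1 * residual ip Xs t N u i).
Proof.
move=> dN pN e0.
have uN : orthonormal_on ip (fun j => j < N)%N u.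
  by have [[ou _] _ _] := eb => j k jN kN; apply: ou; exact: pN.
have ud : orthonormal_on ip (fun j => j < d)%N u.
  by move=> j k jd kd; apply: uN; exact: ltn_trans dN.
set Sh := empirical_covariance ip Xs t; set A := error ip Sigma Xs t.
set f := uhat t.
have risk := excess_risk_le nrm SS eb lam_ge0 pd (@onhat t) sum_eigen_le (ltnW dN).
have restrict (F : nat -> R) :
    \sum_(0 <= j < N | below p j) F j = \sum_(0 <= j < N) F j.
  rewrite big_nat_cond [RHS]big_nat_cond; apply: eq_bigl => j.
  by rewrite leq0n /= andbT andb_idr //; exact: pN.
have ky := ky_fan nrm (empirical_adjoint ip Xs t) (ebhat t) pd (lamhat_ge0 t pd) ud.
have eig : \sum_(0 <= a < d) lamhat t a = \sum_(0 <= a < d) ip (Sh (f a)) (f a).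
  rewrite big_nat_cond [RHS]big_nat_cond; apply: eq_bigr => a.
  rewrite andbT => /andP[_ ad]; have [_ eS _] := ebhat t.
  by rewrite /Sh eS ?pj ?(ltnW ad) // ipZl onhat // eqxx mulr1.
have f1 a : (a < d)%N -> `|f a| = 1.
  move=> ad; have : `|f a| ^+ 2 = 1 by rewrite nrm onhat // eqxx.
  by move/eqP; rewrite sqrf_eq1 => /orP[/eqP//|/eqP fa]; have := normr_ge0 (f a); lra.
have trunc : \sum_(0 <= a < d) ip (Sh (f a)) (f a) <=
    \sum_(0 <= a < d) ip (Sh (part ip N u f a 0)) (part ip N u f a 0) +
    \sum_(0 <= a < d) n%:R^-1 * \sum_(i < n)
     (e * `|Xs i t| ^+ 2 + e^-1 * residual ip Xs t N u i).
  rewrite -big_split /= big_nat_cond [leRHS]big_nat_cond; apply: ler_sum => a.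
  rewrite andbT => /andP[_ ad].
  exact: (truncated_form_le nrm Xs t uN e0 (f1 a ad)).
have rows := rows_bound nrm (error_adjoint cov Xs t) uN (ltnW dN) (@onhat t).
have formP a : ip (Sigma (part ip N u f a 0)) (part ip N u f a 0) =
    \sum_(0 <= j < N) lam j * ip (f a) (u j) ^+ 2.
  rewrite /part block_comb -/(form ip Sigma _) (block_form cov eb pN).
  by rewrite -(sum_block N 0 (fun j => lam j * ip (f a) (u j) ^+ 2)).
have sumP : \sum_(0 <= a < d) ip (Sigma (part ip N u f a 0)) (part ip N u f a 0) =
    \sum_(0 <= j < N) lam j * overlap ip u f d j.
  under eq_bigr do rewrite formP.
  by rewrite exchange_big /=; apply: eq_bigr => j _; rewrite mulr_sumr.
have lamE : \sum_(0 <= j < d) lam j = \sum_(0 <= j < d) ip (Sigma (u j)) (u j).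
  rewrite big_nat_cond [RHS]big_nat_cond; apply: eq_bigr => j.
  by rewrite andbT => /andP[_ /ltnW jd]; rewrite -(form_eigen (pj jd)).
have splitA (F : nat -> H) : \sum_(0 <= a < d) ip (A (F a)) (F a) =
    \sum_(0 <= a < d) ip (Sh (F a)) (F a) - \sum_(0 <= a < d) ip (Sigma (F a)) (F a).
  by rewrite -sumrB; apply: eq_bigr => a _; rewrite /A /error ipBl.
move: risk rows; rewrite restrict -sumP lamE -/A -/f !splitA.
move: ky trunc; rewrite eig -/Sh; lra.
Qed.

Lemma expected_excess_risk :
  measurable_fun [set: T] (fun t => excess_risk ip p Sigma u d (uhat t)) ->
  ('E_P[(fun t => excess_risk ip p Sigma u d (uhat t))] <=
     ((804 * kappa C1 + 2) * \sum_(0 <= j < d)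
            Num.max (Num.sqrt (lam j * tail_trace p lam j / n%:R))
                    (tail_trace p lam j / n%:R))%:E)%E.
Proof.
move=> mE; rewrite unlock.
have k0 : 0 < kappa C1 by exact: kappa_gt0.
have nR0 : (0 : R) < n%:R by rewrite ltr0n.
apply: integral_mean_le.
  apply: (@le_integrable _ _ _ _ _ _ _ (fun=> second_moment%:E)) => //.
  - exact/measurable_EFinP.
  - move=> t _ /=; rewrite lee_fin; apply: le_trans (ler_norm _).
    exact: (excess_risk_bounded nrm SS eb lam_ge0 pd (@onhat t) sum_eigen_le).
  - by have [] := has_mean_cst P second_moment.
pose tr j := tail_trace p lam j.
have tr_ge j N : (forall k, (k < N)%N -> below p k) -> \sum_(j <= k < N) lam k <= tr j.
  move=> pN; apply: le_trans (tail_trace_ge lam_ge0 sum_eigen_le j N).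
  rewrite big_nat_cond [leRHS]big_nat_cond.
  rewrite (eq_bigl (fun k => (j <= k < N)%N && below p k)) // => k.
  by rewrite andbT; case: (boolP (k < N)%N) => [/pN ->|_]; rewrite ?andbT ?andbF.
have lam_tr j : (j <= d)%N -> lam j <= tr j.
  move=> jd; have := tr_ge j j.+1; rewrite big_nat1; apply => k.
  by rewrite ltnS => kj; apply: pj; exact: leq_trans jd.
have ld : 0 < lam d by exact: lam_gt0.
have trd : 0 < tr d := lt_le_trans ld (lam_tr d (leqnn d)).
pose del := tr d / n%:R.
have del0 : 0 < del by rewrite divr_gt0.
have pw0 : 0 <= second_moment by have := sum_eigen_le 0; rewrite big_geq.
(* The truncation budget del is split in two: e times the second moment takes one half, and N is
   then chosen with missing trace at most e del / 2, so that the factor 1 / e costs the other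
   half. *)
pose e := del / (2 * (second_moment + 1)).
have e0 : 0 < e by rewrite divr_gt0 // mulr_gt0 //; lra.
have epw : e * second_moment <= del / 2.
  have -> : e * second_moment = del / 2 * (second_moment / (second_moment + 1)).
    by rewrite /e; field; rewrite gt_eqF //; lra.
  by rewrite ler_piMr ?ler_pdivrMr; lra.
have [N [dN pN hN]] := sum_eigen_close pd (mulr_gt0 e0 (divr_gt0 del0 (ltr0n R 2))).
have rowsM : mean_le P
    (fun t => \sum_(0 <= j < d | (j < d)%N) row_norm ip (error ip Sigma Xs t) N u j)
    (\sum_(0 <= j < d | (j < d)%N) 12 * kappa C1 * Num.sqrt (lam j * tr j / n%:R)).
  apply: mean_le_sum => j jd.
  by apply: (row_norm_mean nrm mX cov sg n0 iid eb lam_gt0 pN);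
    [exact: ltn_trans dN|exact: tr_ge].
have [G GM GP] := block_sup_mean nrm mX cov sg n0 iid eb lam_gt0 pN dN
  (lam_tr d (leqnn d)) (tr_ge d N pN).
have blockM : mean_le P (fun t => \sum_(0 <= a < d) G t)
    (\sum_(0 <= a < d) (768 * kappa C1 * rate n (lam d) (tr d) + del)).
  by apply: mean_le_sum.
have resM i : has_mean P (fun t => residual ip Xs t N u i)
    (second_moment + -1 * \sum_(0 <= j < N | (j < N)%N) lam j).
  rewrite /residual; under eq_fun do rewrite -(big_nat_ltn _ N) -mulN1r.
  apply: has_meanD => //; apply: has_meanZ; apply: has_mean_sum => j jN.
  by rewrite -(form_eigen (pN _ jN)); exact: (has_mean_copy_ip nrm mX cov iid).
have errM : mean_le P (fun t => \sum_(0 <= a < d) n%:R^-1 * \sum_(i < n)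
     (e * `|Xs i t| ^+ 2 + e^-1 * residual ip Xs t N u i))
    (\sum_(0 <= a < d) del).
  apply: mean_le_sum => a _; apply: (@mean_leW _ _ _ _ _ _ _ _ (fun=> lexx _) _ (mean_le_of _)).
    2: apply: has_meanZ; apply: has_mean_sum => i _;
       apply: has_meanD; apply: has_meanZ; [exact: has_mean_power|exact: resM].
  rewrite sumr_const card_ord; set Q := e * second_moment + _.
  rewrite -[Q *+ n]mulr_natl mulKf ?gt_eqF // /Q big_nat_ltn mulN1r.
  have : e^-1 * (second_moment - \sum_(0 <= j < N) lam j) <= del / 2.
    by rewrite ler_pdivrMl.
  lra.
have total := mean_leD (mean_leD (mean_leZ (ler0n R 3) rowsM) blockM) errM.
apply: mean_leW total.
  move=> t; apply: le_trans (excess_risk_decomposition t dN pN e0) _.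
  rewrite !lerD2r big_nat_ltn; apply: lerD => //.
  rewrite big_nat_cond [leRHS]big_nat_cond; apply: ler_sum => a.
  rewrite andbT => /andP[_ ad]; apply: GP.
  have uN : orthonormal_on ip (fun j => j < N)%N u.
    by have [[ou _] _ _] := eb => j k jN kN; apply: ou; exact: pN.
  apply: le_trans (comb_bessel nrm uN _ _) _.
  by rewrite nrm onhat // eqxx.
rewrite big_nat_ltn mulr_sumr -!big_split /= mulr_sumr.
rewrite big_nat_cond [leRHS]big_nat_cond; apply: ler_sum => j.
rewrite andbT => /andP[_ jd].
(* By monotonicity the block, rounding and truncation bounds at d are all dominated by the rate at
   j, so the d copies of each are absorbed by the sum over j < d. *)
have lj : lam d <= lam j by have [_ _] := eb; apply => //; exact: ltnW.
have tj : tr d <= tr j by apply: (tail_trace_le lam_ge0 sum_eigen_le); exact: ltnW.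
rewrite -/(tr j) -/(rate n (lam j) (tr j)).
have r1 : Num.sqrt (lam j * tr j / n%:R) <= rate n (lam j) (tr j) by rewrite le_max lexx.
have r2 : del <= rate n (lam j) (tr j).
  by rewrite le_max; apply/orP; right; rewrite ler_pM2r ?invr_gt0.
have r3 : rate n (lam d) (tr d) <= rate n (lam j) (tr j).
  rewrite ge_max r2 andbT le_max; apply/orP; left.
  rewrite ler_wsqrtr // ler_pM2r ?invr_gt0 //.
  by apply: ler_pM => //; exact: ltW.
move: (rate n (lam j) (tr j)) (rate n (lam d) (tr d)) (Num.sqrt _) r1 r2 r3.
by move=> A B D r1 r2 r3; nra.
Qed.

End ExcessRiskBound.

Theorem proposition2p5 (R : realType) (C1 : R) :
  exists C : R, 0 < C /\
  forall (H : completeNormedModType R) (ip : {dot H for idfun})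
    (p : option nat)
    (dT : measure_display) (T : measurableType dT) (P : probability T R)
    (X : T -> H) (Sigma : H -> H) (lam : nat -> R) (u : nat -> H)
    (n d : nat) (Xs : 'I_n -> T -> H)
    (lamhat : T -> nat -> R) (uhat : T -> nat -> H),
    induces_norm ip ->
    random_vector X ->
    square_integrable P X ->
    is_mean ip P X 0 ->
    is_covariance ip P X Sigma ->
    eigenbasis ip p Sigma lam u ->
    (forall j, below p j -> 0 < lam j) ->
    (1 <= n)%N ->
    iid_copies P X Xs ->
    (forall t, eigenbasis ip p (empirical_covariance ip Xs t)
                 (lamhat t) (uhat t)) ->
    (forall t j, below p j -> 0 <= lamhat t j) ->
    (1 <= d)%N -> below p d ->
    measurable_fun [set: T] (fun t => excess_risk ip p Sigma u d (uhat t)) ->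
    sub_gaussian ip P X C1 ->
    ('E_P[(fun t => excess_risk ip p Sigma u d (uhat t))] <=
     (C * \sum_(0 <= j < d)
            Num.max (Num.sqrt (lam j * tail_trace p lam j / n%:R))
                    (tail_trace p lam j / n%:R))%:E)%E.
Proof.
exists (804 * kappa C1 + 2); split; first by have := kappa_gt0 C1; lra.
move=> H ip p dT T P X Sigma lam u n d Xs lamhat uhat nrm mX sqX _ cov eb l0 n0.
move=> iid ebhat lh0 _ pd mE sg.
exact: (expected_excess_risk nrm mX sqX cov sg n0 iid eb l0 ebhat lh0 pd mE).
Qed.
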